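(* Let $(X,d)$ and $(Y,l)$ be compact metric spaces and let $T(X)$ and $T(Y)$ be finite approximations of $X$ and $Y$ respectively. Then the set of shape morphisms from $X$ to $Y$ is in bijective correspondence with the set of morphisms in pro-$HTop$ from $T(X)$ to $T(Y)$.
   Context: For a compact metric space $(X,d)$: a finite $A\subset X$ is an $\epsilon$-approximation if every $x\in X$ satisfies $d(x,a)<\epsilon$ for some $a\in A$; $\mathcal{U}_{r}(A)$ is the set of nonempty subsets of $A$ of diameter $<r$, a finite poset under inclusion regarded as a finite $T_0$ space whose open sets are the down-sets. A finite approximation of $X$ is an inverse sequence $(\mathcal{U}_{4\epsilon_n}(A_n),q_{n,n+1})$ where $\epsilon_n>0$, $\epsilon_{n+1}<\epsilon_n/2$, $A_n$ is an $\epsilon_n$-approximation, and $q_{n,n+1}(C)=\bigcup_{c\in C}\mathcal{B}(c,\epsilon_n)\cap A_n$ ($\mathcal{B}$ the open ball). $HTop$ is the homotopy category of topological spaces and pro-$HTop$ its pro-category: a morphism between inverse sequences $(X_n,p_{n,n+1})\to(Y_n,q_{n,n+1})$ is represented by an increasing $f:\mathbb{N}\to\mathbb{N}$ and maps $f_n:X_{f(n)}\to Y_n$ with $q_{n,n+1}\circ f_{n+1}\simeq f_n\circ p_{f(n),f(n+1)}$, two representatives $(f_n,f),(g_n,g)$ being equivalent if for each $n$ some $m\ge f(n),g(n)$ gives $f_n\circ p_{f(n),m}\simeq g_n\circ p_{g(n),m}$. Shape morphisms are those of the usual (Borsuk / Mardešić–Segal) shape category of compact metric spaces. *)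

(* Defs.v *)
From HB Require Import structures.
From mathcomp Require Import all_boot all_order all_algebra.
From mathcomp Require Import all_classical all_reals all_analysis.
Set Implicit Arguments. Unset Strict Implicit. Unset Printing Implicit Defensive.
Import Order.TTheory GRing.Theory Num.Theory.
Import numFieldTopology.Exports.
Local Open Scope classical_set_scope.
Local Open Scope ring_scope.

(** * Finite T0 spaces: a family of subsets ordered by inclusion, with the
    Alexandrov topology whose open sets are the down-sets.  We put this
    topology on the whole type [set T] (ordered by inclusion); a subfamily
    (e.g. U_r(A)) then carries the subspace topology, whose open sets are
    exactly the down-sets of the subposet. *)
Definition alex (T : Type) := set T.
HB.instance Definition _ (T : Type) := gen_eqMixin (alex T).
HB.instance Definition _ (T : Type) := gen_choiceMixin (alex T).

Definition alex_open (T : Type) : set_system (alex T) :=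
  fun F => forall C D : set T, F C -> D `<=` C -> F D.

Lemma alex_openT (T : Type) : alex_open [set: alex T].
Proof. by []. Qed.

Lemma alex_openI (T : Type) : setI_closed (@alex_open T).
Proof.
move=> F G hF hG C D [FC GC] DC; split; [exact: hF FC DC | exact: hG GC DC].
Qed.

Lemma alex_open_bigU (T : Type) (I : Type) (f : I -> set (alex T)) :
  (forall i, alex_open (f i)) -> alex_open (\bigcup_i f i).
Proof. by move=> hf C D [i _ fiC] DC; exists i => //; exact: hf fiC DC. Qed.

HB.instance Definition _ (T : Type) :=
  isOpenTopological.Build (alex T) (@alex_openT T) (@alex_openI T)
    (@alex_open_bigU T).

Definition unit_interval (R : realType) : set R := [set t | 0 <= t <= 1].
Arguments unit_interval R : clear implicits.

Definition homotopic_on (R : realType) (S T : topologicalType)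
    (A : set S) (B : set T) (f g : S -> T) : Prop :=
  exists H : S * R -> T,
    [/\ {within A `*` unit_interval R, continuous H},
        (forall x t, A x -> unit_interval R t -> B (H (x, t))) &
        (forall x, A x -> H (x, 0) = f x /\ H (x, 1) = g x)].

(** * Borsuk shape morphisms (fundamental sequences) for compacta in the
    Hilbert cube Q = [0,1]^N (product topology). *)
Definition HC (R : realType) := {ptws nat -> R}.
Definition hcube (R : realType) : set (HC R) :=
  [set x | forall n, 0 <= x n <= 1].
Arguments hcube R : clear implicits.

Definition qnbhd (R : realType) (K V : set (HC R)) : Prop :=
  [/\ K `<=` V & exists O : set (HC R), open O /\ V = O `&` hcube R].

(** A map into Q that is an embedding (continuous, injective; the domain being
    compact, this is a topological embedding). *)
Definition hc_embedding (R : realType) (X : topologicalType) (i : X -> HC R) :=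
  [/\ continuous i, injective i & forall x, hcube R (i x)].

Definition fund_seq (R : realType) (KX KY : set (HC R))
    (f : nat -> HC R -> HC R) : Prop :=
  (forall k, {within hcube R, continuous f k} /\
             (forall x, hcube R x -> hcube R (f k x))) /\
  forall V, qnbhd KY V -> exists U, qnbhd KX U /\
    exists k0, forall k, (k0 <= k)%N -> homotopic_on R U V (f k) (f k.+1).

Definition fund_equiv (R : realType) (KX KY : set (HC R))
    (f g : nat -> HC R -> HC R) : Prop :=
  forall V, qnbhd KY V -> exists U, qnbhd KX U /\
    exists k0, forall k, (k0 <= k)%N -> homotopic_on R U V (f k) (g k).

Definition ShapeMor (R : realType) (KX KY : set (HC R)) :=
  {C : set (nat -> HC R -> HC R) | exists f, fund_seq KX KY f /\
     C = [set g | fund_seq KX KY g /\ fund_equiv KX KY f g]}.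

Section FiniteApprox.
Context {R : realType} {X : metricType R}.

Definition eps_approx (A : set X) (e : R) : Prop :=
  finite_set A /\ forall x : X, exists a, A a /\ mdist x a < e.

(** U_r(A): nonempty subsets of A of diameter < r (A finite, so the diameter
    is a maximum and "diam < r" means all pairwise distances are < r). *)
Definition Ur (r : R) (A : set X) : set (alex X) :=
  [set C | [/\ C !=set0, C `<=` A &
             forall a b, C a -> C b -> mdist a b < r]].

Definition finite_approx (eps : nat -> R) (A : nat -> set X) : Prop :=
  [/\ forall n, 0 < eps n, forall n, eps n.+1 < eps n / 2 &
      forall n, eps_approx (A n) (eps n)].

Definition lvl (eps : nat -> R) (A : nat -> set X) (n : nat) : set (alex X) :=
  Ur (4 * eps n) (A n).

Definition bond (eps : nat -> R) (A : nat -> set X) (n : nat) :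
    alex X -> alex X :=
  fun C => [set a | A n a /\ exists c, C c /\ mdist c a < eps n].

Fixpoint bondk (eps : nat -> R) (A : nat -> set X) (n k : nat) :
    alex X -> alex X :=
  match k with
  | 0 => id
  | k'.+1 => fun C => bondk eps A n k' (bond eps A (n + k') C)
  end.

Definition bondnm (eps : nat -> R) (A : nat -> set X) (n m : nat) :=
  bondk eps A n (m - n).
End FiniteApprox.

Section ProHTop.
Context {R : realType} {X Y : metricType R}.
Variables (epsX : nat -> R) (AX : nat -> set X)
          (epsY : nat -> R) (AY : nat -> set Y).

Definition pro_rep (r : (nat -> nat) * (nat -> alex X -> alex Y)) : Prop :=
  let phi := r.1 in let fm := r.2 in
  [/\ {homo phi : m n / (m <= n)%N},
      (forall n, {within lvl epsX AX (phi n), continuous fm n} /\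
         forall C, lvl epsX AX (phi n) C -> lvl epsY AY n (fm n C)) &
      (forall n, homotopic_on R (lvl epsX AX (phi n.+1)) (lvl epsY AY n)
          (bond epsY AY n \o fm n.+1)
          (fm n \o bondnm epsX AX (phi n) (phi n.+1)))].

Definition pro_equiv (r s : (nat -> nat) * (nat -> alex X -> alex Y)) : Prop :=
  forall n, exists m, [/\ (r.1 n <= m)%N, (s.1 n <= m)%N &
    homotopic_on R (lvl epsX AX m) (lvl epsY AY n)
      (r.2 n \o bondnm epsX AX (r.1 n) m)
      (s.2 n \o bondnm epsX AX (s.1 n) m)].

Definition ProMor :=
  {C : set ((nat -> nat) * (nat -> alex X -> alex Y)) |
     exists r, pro_rep r /\ C = [set s | pro_rep s /\ pro_equiv r s]}.
End ProHTop.

(* Main.v *)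
(** Both sides are compared with proximate sequences: sequences of arbitrary
    functions [g_n : X -> Y] such that, for every [e], eventually [g_n] and
    [g_(n+1)] are joined by a finite chain of functions in which consecutive
    members send [d]-close points to [e]-close points, for some [d] depending
    on [n]; equivalence of two sequences is defined in the same way.

    A morphism of finite approximations gives a proximate sequence by selecting
    a point of [f_n {a}] for [a] near [x].  Homotopies of maps of finite spaces
    become chains because the value at a time [t] contains the values at nearby
    times and [[0,1]] is connected.  Conversely [g_n] induces the monotone map
    sending [C] to the set of net points near [g_n(C)], and two monotone maps
    whose union still has small diameter are homotopic through that union.

    A fundamental sequence gives a proximate sequence by restricting to [X] and
    moving to a nearby point of [Y].  Conversely, a partition of unity over a
    net of [X] turns a function [X -> Y] into a map of the cube, and all the
    required homotopies are straight lines, since the balls of the chosen metric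
    of the cube are convex. *)
Require Import Defs.
From HB Require Import structures.
From mathcomp Require Import all_boot all_order all_algebra.
From mathcomp Require Import all_classical all_reals all_analysis.
From mathcomp Require Import zify ring lra.
Set Implicit Arguments. Unset Strict Implicit. Unset Printing Implicit Defensive.
Import Order.TTheory GRing.Theory Num.Theory.
Import numFieldTopology.Exports.
Local Open Scope classical_set_scope.
Local Open Scope ring_scope.

(** * Classes encoded by a common invariant *)

(** Proximate sequences consist of arbitrary functions because points of finite sets, or points of
    [Y] near a given point of the cube, cannot be selected continuously; only continuity at some
    scale [d] survives. On the finite side the radius [4 * eps] is what makes this work: net points
    selected within [eps] of two points at distance below [2 * eps] lie in a common member of the
    level, and controlling [g_n] up to [eps / 2] leaves room for the unions. On the shape side the
    obstacle is uniformity: a fundamental sequence needs one neighbourhood for all large indices,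
    whereas the scale of a chain may shrink with the index. Hence the sequence is slowed down to
    single steps, and successive maps of the cube are altered only in shrinking tubes around [X]. *)

Definition classes (A : Type) (P : A -> Prop) (E : A -> A -> Prop) :=
  {C : set A | exists a, P a /\ C = [set b | P b /\ E a b]}.

Record equiv_on (A : Type) (P : A -> Prop) (E : A -> A -> Prop) : Prop :=
  EquivOn {
    equiv_refl : forall a, P a -> E a a ;
    equiv_sym : forall a b, P a -> P b -> E a b -> E b a ;
    equiv_trans : forall a b c, P a -> P b -> P c -> E a b -> E b c -> E a c
  }.

(** [Q] is a relation because the proximate sequence depends on selections. [encode_equiv] is at
    once well-definedness and injectivity on classes; surjectivity is only asked up to [EM]. *)
Record encodes (A M : Type) (PA : A -> Prop) (EA : A -> A -> Prop)
    (PM : M -> Prop) (EM : M -> M -> Prop) (Q : A -> M -> Prop) : Prop :=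
  Encodes {
    encode_tot : forall a, PA a -> exists m, Q a m ;
    encode_mem : forall a m, PA a -> Q a m -> PM m ;
    encode_equiv : forall a a' m m', PA a -> PA a' -> Q a m -> Q a' m' ->
      EA a a' <-> EM m m' ;
    encode_surj : forall m, PM m -> exists a m', [/\ PA a, Q a m' & EM m' m]
  }.

Section Encodings.
Variables (A M : Type) (PA : A -> Prop) (EA : A -> A -> Prop).
Variables (PM : M -> Prop) (EM : M -> M -> Prop) (Q : A -> M -> Prop).
Hypothesis eqM : equiv_on PM EM.
Hypothesis encA : encodes PA EA PM EM Q.

(** [EA] inherits the three laws from [EM] through [encode_equiv], so they are not checked
    separately for the two homotopy relations. *)
Lemma encodes_equiv_on : equiv_on PA EA.
Proof.
split.
- move=> a Pa; have [m am] := encode_tot encA Pa.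
  apply/(encode_equiv encA Pa Pa am am); apply: (equiv_refl eqM).
  exact: (encode_mem encA Pa am).
- move=> a b Pa Pb; have [m am] := encode_tot encA Pa.
  have [n bn] := encode_tot encA Pb.
  move=> /(encode_equiv encA Pa Pb am bn) mn.
  apply/(encode_equiv encA Pb Pa bn am); apply: (equiv_sym eqM _ _ mn).
    exact: (encode_mem encA Pa am).
  exact: (encode_mem encA Pb bn).
- move=> a b c Pa Pb Pc; have [m am] := encode_tot encA Pa.
  have [n bn] := encode_tot encA Pb; have [p cp] := encode_tot encA Pc.
  move=> /(encode_equiv encA Pa Pb am bn) mn /(encode_equiv encA Pb Pc bn cp) np.
  apply/(encode_equiv encA Pa Pc am cp).
  apply: (equiv_trans eqM _ _ _ mn np);
    [exact: (encode_mem encA Pa am) | exact: (encode_mem encA Pb bn)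
    | exact: (encode_mem encA Pc cp)].
Qed.

Lemma class_mem (C : classes PA EA) : exists a, PA a /\ sval C a.
Proof.
case: C => C [a [Pa CE]]; exists a; split=> //=.
by rewrite CE /=; split=> //; apply: (equiv_refl encodes_equiv_on).
Qed.

Lemma class_memP (C : classes PA EA) a : sval C a -> PA a.
Proof. by case: C => C [b [Pb CE]] /=; rewrite CE => -[]. Qed.

Lemma class_equiv (C : classes PA EA) a b : sval C a -> sval C b -> EA a b.
Proof.
have eqA := encodes_equiv_on.
case: C => C [c [Pc CE]] /=; rewrite CE => -[Pa ca] [Pb cb].
exact: (equiv_trans eqA Pa Pc Pb (equiv_sym eqA Pc Pa ca) cb).
Qed.

Lemma class_eq (C D : classes PA EA) a b :
  sval C a -> sval D b -> EA a b -> C = D.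
Proof.
have eqA := encodes_equiv_on.
move=> Ca Db ab; have Pa := class_memP Ca; have Pb := class_memP Db.
case: C D Ca Db => C [c [Pc CE]] [D [d [Pd DE]]] /= Ca Db.
apply: eq_exist; apply/seteqP; move: Ca Db.
rewrite CE DE => -[_ ca] [_ db].
have cd : EA c d.
  apply: (equiv_trans eqA Pc Pa Pd ca).
  exact: (equiv_trans eqA Pa Pb Pd ab (equiv_sym eqA Pd Pb db)).
split=> x [Px xE]; split=> //; last exact: (equiv_trans eqA Pc Pd Px cd xE).
exact: (equiv_trans eqA Pd Pc Px (equiv_sym eqA Pc Pd cd) xE).
Qed.

Lemma class_exists a : PA a -> exists C : classes PA EA, sval C a.
Proof.
move=> Pa.
have H : exists b, PA b /\ [set b | PA b /\ EA a b] = [set c | PA c /\ EA b c].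
  by exists a.
exists (exist _ [set b | PA b /\ EA a b] H); split=> //.
exact: (equiv_refl encodes_equiv_on).
Qed.

End Encodings.

Section EncodingsBij.
Variables (A B M : Type) (PA : A -> Prop) (EA : A -> A -> Prop).
Variables (PB : B -> Prop) (EB : B -> B -> Prop).
Variables (PM : M -> Prop) (EM : M -> M -> Prop).
Variables (QA : A -> M -> Prop) (QB : B -> M -> Prop).
Hypothesis eqM : equiv_on PM EM.
Hypothesis encA : encodes PA EA PM EM QA.
Hypothesis encB : encodes PB EB PM EM QB.

Definition class_match (C : classes PA EA) (D : classes PB EB) :=
  exists a b m n, [/\ sval C a, sval D b, QA a m, QB b n & EM m n].

Lemma class_match_exists C : exists D, class_match C D.
Proof.
have [a [Pa Ca]] := class_mem eqM encA C; have [m am] := encode_tot encA Pa.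
have Pm := encode_mem encA Pa am.
have [b [n [Pb bn nm]]] := encode_surj encB Pm.
have [D Db] := class_exists eqM encB Pb.
exists D, a, b, m, n; split=> //.
exact: (equiv_sym eqM (encode_mem encB Pb bn) Pm nm).
Qed.

Lemma class_match_fun C D D' : class_match C D -> class_match C D' -> D = D'.
Proof.
move=> [a [b [m [n [Ca Db am bn mn]]]]] [a' [b' [m' [n' [Ca' Db' am' bn' mn']]]]].
apply: (class_eq eqM encB Db Db').
have [Pa Pa'] := (class_memP Ca, class_memP Ca').
have [Pb Pb'] := (class_memP Db, class_memP Db').
have [Pm Pm'] := (encode_mem encA Pa am, encode_mem encA Pa' am').
have [Pn Pn'] := (encode_mem encB Pb bn, encode_mem encB Pb' bn').
apply/(encode_equiv encB Pb Pb' bn bn').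
apply: (equiv_trans eqM Pn Pm Pn' (equiv_sym eqM Pm Pn mn)).
apply: (equiv_trans eqM Pm Pm' Pn' _ mn').
exact/(encode_equiv encA Pa Pa' am am')/(class_equiv eqM encA Ca Ca').
Qed.

End EncodingsBij.

Lemma class_match_sym (A B M : Type) (PA : A -> Prop) (EA : A -> A -> Prop)
    (PB : B -> Prop) (EB : B -> B -> Prop)
    (PM : M -> Prop) (EM : M -> M -> Prop)
    (QA : A -> M -> Prop) (QB : B -> M -> Prop)
    (C : classes PA EA) (D : classes PB EB) :
  equiv_on PM EM -> encodes PA EA PM EM QA -> encodes PB EB PM EM QB ->
  class_match EM QA QB C D -> class_match EM QB QA D C.
Proof.
move=> eqM encA encB [a [b [m [n [Ca Db am bn mn]]]]].
exists b, a, n, m; split=> //.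
have Pm := encode_mem encA (class_memP Ca) am.
have Pn := encode_mem encB (class_memP Db) bn.
exact: (equiv_sym eqM Pm Pn mn).
Qed.

(** The two maps are chosen independently; they are mutually inverse because a class determines the
    class that it matches. *)
Lemma encodes_bijective (A B M : Type) (PA : A -> Prop) (EA : A -> A -> Prop)
    (PB : B -> Prop) (EB : B -> B -> Prop)
    (PM : M -> Prop) (EM : M -> M -> Prop)
    (QA : A -> M -> Prop) (QB : B -> M -> Prop) :
  equiv_on PM EM -> encodes PA EA PM EM QA -> encodes PB EB PM EM QB ->
  exists Phi : classes PA EA -> classes PB EB, bijective Phi.
Proof.
move=> eqM encA encB.
have [Phi PhiP] := choice (class_match_exists eqM encA encB).
have [Psi PsiP] := choice (class_match_exists eqM encB encA).
exists Phi; exists Psi.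
  move=> C; apply: (class_match_fun eqM encB encA (PsiP _)).
  exact: (class_match_sym eqM encA encB (PhiP C)).
move=> D; apply: (class_match_fun eqM encA encB (PhiP _)).
exact: (class_match_sym eqM encB encA (PsiP D)).
Qed.

(** * Proximate sequences *)

(** Partial sums do it. This makes thresholds obtained by choice into monotone index functions. *)
Lemma monotone_majorant (P : nat -> nat) :
  exists Q : nat -> nat, {homo Q : m n / (m <= n)%N} /\ forall n, (P n <= Q n)%N.
Proof.
exists (fun n => \sum_(i < n.+1) P i)%N; split.
  move=> m n mn; rewrite -(subnKC mn) -addSn big_split_ord /=; exact: leq_addr.
by move=> n; rewrite big_ord_recr /=; exact: leq_addl.
Qed.

Lemma small_inv {R : realType} (e : R) : 0 < e ->
  exists k, forall m, (k <= m)%N -> m.+1%:R^-1 < e.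
Proof.
move=> e0; exists (Num.truncn e^-1) => m km; rewrite invf_plt ?posrE //.
by apply: lt_le_trans (Num.Theory.truncnS_gt _) _; rewrite ler_nat.
Qed.

Section Chains.
Context {R : realType} {X Y : metricType R}.
Implicit Types (d e : R).

(** A metric form of contiguity of simplicial maps. The bound between [h x] and [g x'] follows by
    exchanging the points; [contig d e g g] is continuity of [g] at scale [d] up to [e]. *)
Definition contig d e (g h : X -> Y) := forall x x', mdist x x' < d ->
  [/\ mdist (g x) (g x') < e, mdist (h x) (h x') < e & mdist (g x) (h x') < e].

(** The chain is an infinite sequence, stationary from [l], so that its steps need no bound on the
    index. *)
Definition chained d e (g h : X -> Y) := exists (p : nat -> X -> Y) (l : nat),
  [/\ p 0 = g, forall i, (l <= i)%N -> p i = h &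
      forall i, contig d e (p i) (p i.+1)].

Definition linked e (g h : X -> Y) := exists d, 0 < d /\ chained d e g h.

Lemma contig_sym d e (g h : X -> Y) : contig d e g h -> contig d e h g.
Proof.
move=> gh x x' xx'; have [? ? ?] := gh _ _ xx'; split=> //.
by rewrite metric_sym; have [] : [/\ mdist (g x') (g x) < e,
  mdist (h x') (h x) < e & mdist (g x') (h x) < e] by apply: gh; rewrite metric_sym.
Qed.

Lemma contig_refl d e (g h : X -> Y) : contig d e g h -> contig d e g g.
Proof. by move=> gh x x' /gh[]. Qed.

Lemma contig_le d d' e e' (g h : X -> Y) : d' <= d -> e <= e' ->
  contig d e g h -> contig d' e' g h.
Proof.
move=> dd ee gh x x' xx'; have [? ? ?] := gh _ _ (lt_le_trans xx' dd).
by split; apply: lt_le_trans ee.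
Qed.

Lemma chained_le d d' e e' (g h : X -> Y) : d' <= d -> e <= e' ->
  chained d e g h -> chained d' e' g h.
Proof.
move=> dd ee [p [l [p0 pl pc]]]; exists p, l; split=> // i.
exact: contig_le (pc i).
Qed.

Lemma chained_contig d e (g h : X -> Y) : chained d e g h -> contig d e g g.
Proof. by case=> p [l [<- _ /(_ 0)]]; exact: contig_refl. Qed.

Lemma contig_chained d e (g h : X -> Y) : contig d e g h -> chained d e g h.
Proof.
move=> gh; exists (fun i => if i is 0 then g else h), 1%N; split=> //.
  by case.
by case=> // i; apply: (contig_refl (contig_sym gh)).
Qed.

Lemma chained_sym d e (g h : X -> Y) : chained d e g h -> chained d e h g.
Proof.
move=> [p [l [p0 pl pc]]]; exists (fun i => p (l - i)%N), l; split.
- by rewrite subn0 pl.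
- by move=> i; rewrite -subn_eq0 => /eqP ->.
- move=> i; have [il|li] := ltnP i l.
    by apply: contig_sym; have := pc (l - i.+1)%N; rewrite -subSn.
  move: (li) (leqW li); rewrite -!subn_eq0 => /eqP-> /eqP->.
  exact: contig_refl (pc 0).
Qed.

Lemma chained_trans d e (g h k : X -> Y) :
  chained d e g h -> chained d e h k -> chained d e g k.
Proof.
move=> [p [l [p0 pl pc]]] [q [m [q0 qm qc]]].
exists (fun i => if (i < l)%N then p i else q (i - l)%N), (l + m)%N; split.
- by case: ltnP p0 => //; rewrite leqn0 => /eqP l0 <-; rewrite l0 q0 -(pl 0) // l0.
- move=> i lmi; have /negbTE -> : ~~ (i < l)%N by rewrite -leqNgt; lia.
  by apply: qm; lia.
- move=> i; case: ltnP => [il|li]; last first.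
    by have -> : (i.+1 < l)%N = false by [lia]; rewrite subSn.
  case: ltnP => // il'; have -> : (i.+1 - l = 0)%N by lia.
  by rewrite q0 -(pl i.+1).
Qed.

Lemma linked_le e e' (g h : X -> Y) : e <= e' -> linked e g h -> linked e' g h.
Proof. by move=> ee [d [d0 gh]]; exists d; split=> //; exact: chained_le gh. Qed.

Lemma contig_linked d e (g h : X -> Y) : 0 < d -> contig d e g h -> linked e g h.
Proof. by move=> d0 gh; exists d; split=> //; exact: contig_chained. Qed.

Lemma linked_sym e (g h : X -> Y) : linked e g h -> linked e h g.
Proof. by move=> [d [d0 gh]]; exists d; split=> //; exact: chained_sym. Qed.

Lemma linked_trans e (g h k : X -> Y) : linked e g h -> linked e h k -> linked e g k.
Proof.
move=> [d [d0 gh]] [d' [d'0 hk]]; exists (Num.min d d'); split.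
  by rewrite lt_min d0.
by apply: (@chained_trans _ _ _ h); [apply: chained_le gh | apply: chained_le hk];
  rewrite // ge_min lexx ?orbT.
Qed.

Definition prox (g : nat -> X -> Y) := forall e, 0 < e ->
  exists n0, forall n, (n0 <= n)%N -> linked e (g n) (g n.+1).

Definition prox_equiv (g h : nat -> X -> Y) := forall e, 0 < e ->
  exists n0, forall n, (n0 <= n)%N -> linked e (g n) (h n).

Lemma prox_linked (g : nat -> X -> Y) e : prox g -> 0 < e ->
  exists n0, forall n m, (n0 <= n)%N -> (n0 <= m)%N -> linked e (g n) (g m).
Proof.
move=> Pg e0; have [n0 gn] := Pg e e0; exists n0.
have up n k : (n0 <= n)%N -> linked e (g n) (g (n + k)%N).
  move=> n0n; elim: k => [|k IH].
    (* [linked e] is not reflexive on arbitrary functions, so reflexivity comes from one step forth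
       and back. *)
    by rewrite addn0; apply: linked_trans (linked_sym (gn n n0n)); exact: gn.
  by rewrite addnS; apply: linked_trans IH _; apply: gn; lia.
move=> n m n0n n0m; have [nm|mn] := leqP n m.
  by rewrite -(subnKC nm); apply: up.
by apply: linked_sym; rewrite -(subnKC (ltnW mn)); apply: up.
Qed.

Lemma prox_equiv_on : equiv_on prox prox_equiv.
Proof.
split.
- move=> g Pg e e0; have [n0 H] := prox_linked Pg e0.
  by exists n0 => n n0n; exact: H.
- by move=> g h _ _ gh e /gh[n0 H]; exists n0 => n /H /linked_sym.
- move=> g h k _ _ _ gh hk e e0; have [n0 H] := gh e e0; have [n1 K] := hk e e0.
  exists (maxn n0 n1) => n; rewrite geq_max => /andP[/H ? /K ?].
  by apply: linked_trans; eassumption.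
Qed.

Lemma prox_subseq (g : nat -> X -> Y) (s : nat -> nat) :
  prox g -> (forall n, (n <= s n)%N) -> prox_equiv (g \o s) g.
Proof.
move=> Pg sn e e0; have [n0 H] := prox_linked Pg e0; exists n0 => n n0n.
by apply: H => //; exact: leq_trans (sn n).
Qed.

Lemma path_chained d e (p : nat -> X -> Y) i :
  (forall i, contig d e (p i) (p i.+1)) -> chained d e (p 0) (p i).
Proof.
move=> pc; elim: i => [|i IH]; first exact/contig_chained/(contig_refl (pc 0)).
exact: chained_trans IH (contig_chained (pc i)).
Qed.

(* [next] walks along the chain from [G k] to [G k.+1] and then restarts on the
   next one, so that consecutive functions become a single step apart. *)
Lemma prox_slow (g : nat -> X -> Y) : prox g ->
  exists (h : nat -> X -> Y) (kappa : nat -> nat) (d : nat -> R),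
  [/\ forall j, 0 < d j, {homo kappa : i j / (i <= j)%N},
      forall k, exists j, (k <= kappa j)%N,
      forall j, contig (d j) (kappa j).+1%:R^-1 (h j) (h j.+1) &
      prox_equiv h g].
Proof.
move=> Pg; have inv0 k : 0 < k.+1%:R^-1 :> R by rewrite invr_gt0.
have [N0 N0P] := choice (fun k => prox_linked Pg (inv0 k)).
have [N [Nh NP]] := monotone_majorant (fun k => N0 k + k)%N.
pose G k := g (N k).
have /choice[q qP] k : exists q : R * (nat -> X -> Y) * nat,
    [/\ 0 < q.1.1, q.1.2 0 = G k, forall i, (q.2 <= i)%N -> q.1.2 i = G k.+1 &
        forall i, contig q.1.1 k.+1%:R^-1 (q.1.2 i) (q.1.2 i.+1)].
  have [d [d0 [p [l [p0 pl pc]]]]] : linked k.+1%:R^-1 (G k) (G k.+1).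
    apply: N0P; first by have := NP k; lia.
    by have := NP k; have := Nh _ _ (leqnSn k); lia.
  by exists (d, p, l).
pose next (z : nat * nat) :=
  if (z.2.+1 < (q z.1).2)%N then (z.1, z.2.+1) else (z.1.+1, 0%N).
pose st j := iter j next (0%N, 0%N).
have stS j : st j.+1 = next (st j) by [].
have st0 k : exists j, st j = (k, 0%N).
  elim: k => [|k [j jk]]; first by exists 0%N.
  (* The disjunct [i == 0] covers a chain of length zero, which still takes one step of the walk. *)
  have run i : (i < (q k).2)%N || (i == 0)%N -> st (i + j)%N = (k, i).
    elim: i => [|i IH] //; rewrite orbF => il.
    by rewrite addSn stS IH ?(ltnW il) // /next /= il.
  exists ((q k).2.-1.+1 + j)%N; rewrite addSn stS run.
    by rewrite /next /=; have -> : ((q k).2.-1.+1 < (q k).2)%N = false by lia.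
  by lia.
have kh : {homo (fun j => (st j).1) : i j / (i <= j)%N}.
  apply: homo_leq => [//|y x z|j]; first exact: leq_trans.
  by rewrite stS /next; case: ifP => _ /=.
have ku k : exists j, (k <= (st j).1)%N.
  by have [j jk] := st0 k; exists j; rewrite jk.
exists (fun j => (q (st j).1).1.2 (st j).2), (fun j => (st j).1),
  (fun j => (q (st j).1).1.1); split=> //.
- by move=> j; case: (qP (st j).1).
- move=> j; have [_ _ ql qc] := qP (st j).1; rewrite stS /next.
  have [_ q0 _ _] := qP (st j).1.+1.
  case: ltnP => [_|li] /=.
    exact: qc.
  (* At a restart the new function is [G] at the next index, with which the old chain agrees from
     its end on; this is thus still a step of the old chain. *)
  by rewrite q0 -(ql _ li).
- move=> e e0; have [k0 k0P] := small_inv e0; have [n0 n0P] := prox_linked Pg e0.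
  have [j0 j0P] := ku (k0 + n0)%N; exists (j0 + n0)%N => j jj.
  have j0j : (j0 <= j)%N by lia.
  have kj := leq_trans j0P (kh _ _ j0j).
  apply: (@linked_trans _ _ (G (st j).1)); last first.
    by apply: n0P; have := NP (st j).1; lia.
  have [q1 q0 _ qc] := qP (st j).1; apply/linked_sym; rewrite -q0.
  exists (q (st j).1).1.1; split=> //; apply: path_chained => i.
  apply: contig_le (qc i) => //; apply/ltW/k0P; lia.
Qed.

End Chains.

(** * Homotopies *)

Section Interval.
Context {R : realType}.

Lemma unit_intervalE : unit_interval R = [set` `[0, 1]].
Proof. by apply/seteqP; split=> x /=; rewrite in_itv. Qed.

Lemma unit_interval0 : unit_interval R 0.
Proof. by rewrite /unit_interval /= lexx ler01. Qed.

Lemma unit_interval1 : unit_interval R 1.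
Proof. by rewrite /unit_interval /= lexx ler01. Qed.

(** The parameters related to [0] form a subset of the interval that is open and closed: it and its
    complement are both traces of unions of the balls given by the local hypothesis. No continuity
    of [k] enters. *)
Lemma interval_chain (T : Type) (P : T -> T -> Prop) (k : R -> T) :
  (forall a b, P a b -> P b a) -> (forall a b c, P a b -> P b c -> P a c) ->
  (forall t, unit_interval R t -> exists d, 0 < d /\
    forall s, unit_interval R s -> `|s - t| < d -> P (k t) (k s)) ->
  P (k 0) (k 1).
Proof.
move=> Psym Ptr loc.
have /choice[d dP] t : exists d, unit_interval R t -> 0 < d /\
    forall s, unit_interval R s -> `|s - t| < d -> P (k t) (k s).
  have [It|nIt] := pselect (unit_interval R t); last by exists 1.
  by have [d ?] := loc t It; exists d.
pose B := [set t | unit_interval R t /\ P (k 0) (k t)].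
pose O (S : set R) := \bigcup_(t in S) ball t (d t).
have openO S : open (O S).
  by apply: bigcup_open => t St; exact: ball_open.
have inO (S : set R) t : S t -> unit_interval R t -> O S t.
  by move=> St It; exists t => //; apply: ballxx; have [] := dP t It.
have I0 := unit_interval0.
have BE : B = unit_interval R; last first.
  by have : B 1 by [rewrite BE; exact: unit_interval1]; case.
rewrite unit_intervalE; apply: (@segment_connected R 0 1).
- exists 0; split=> //; have [d0 dP0] := dP _ I0; apply: dP0 => //.
  by rewrite subrr normr0.
- exists (O B) => //; rewrite -unit_intervalE; apply/seteqP; split=> t.
    by move=> [It Pt]; split=> //; apply: inO.
  move=> [It [s [Is Ps]]]; rewrite -ball_normE /= distrC => st; split=> //.
  by apply: Ptr Ps _; have [_] := dP s Is; apply.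
- exists (~` O (unit_interval R `\` B)); first exact: open_closedC.
  rewrite -unit_intervalE; apply/seteqP; split=> t.
    move=> [It Pt]; split=> // -[s [Is nBs]].
    rewrite -ball_normE /= distrC => st; apply: nBs; split=> //.
    by apply: Ptr Pt _; apply: Psym; have [_] := dP s Is; apply.
  move=> [It nO]; apply: contrapT => nBt; apply: nO; exact: inO.
Qed.

End Interval.

Lemma within_continuousP (S T : topologicalType) (A : set S) (f : S -> T) :
  {within A, continuous f} <-> forall x, A x -> forall W, nbhs (f x) W ->
    nbhs x [set y | A y -> W (f y)].
Proof. exact: subspace_continuousP. Qed.

Section Homotopy.
Context {R : realType}.
Notation I := (unit_interval R).

Lemma within_homotopyP (S T : topologicalType) (A : set S) (H : S * R -> T) :
  {within A `*` I, continuous H} <->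
  forall x t, A x -> I t -> forall W, nbhs (H (x, t)) W ->
    exists U d, [/\ nbhs x U, 0 < d &
      forall y s, U y -> A y -> I s -> `|s - t| < d -> W (H (y, s))].
Proof.
rewrite within_continuousP; split=> [cH x t Ax It W HW | cH [x t] [Ax It] W HW].
  have [[U V] /= [nU /nbhs_ballP[d /= d0 dV]] UV] := cH (x, t) (conj Ax It) W HW.
  exists U, d; split=> // y s Uy Ay Is st; apply: (UV (y, s)) => //=.
  by split=> //; apply: dV; rewrite -ball_normE /= distrC.
have [U [d [nU d0 UW]]] := cH x t Ax It W HW.
exists (U, ball t d) => /=; first by split=> //; exact: nbhsx_ballx.
move=> [y s] /= [Uy]; rewrite -ball_normE /= distrC => st [Ay Is]; exact: UW.
Qed.

Lemma homotopic_on_sub (S T : topologicalType) (A A' : set S) (B : set T) f g :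
  A' `<=` A -> homotopic_on R A B f g -> homotopic_on R A' B f g.
Proof.
move=> sA [H [cH HB H01]]; exists H; split.
- by apply: continuous_subspaceW cH => -[x t] /= [? ?]; split=> //; exact: sA.
- by move=> x t /sA; exact: HB.
- by move=> x /sA; exact: H01.
Qed.

Lemma homotopic_on_in (S T : topologicalType) (A : set S) (B : set T)
    (f g : S -> T) : homotopic_on R A B f g -> forall x, A x -> B (f x).
Proof.
move=> [H [_ HB H01]] x Ax; rewrite -(H01 x Ax).1.
by apply: HB => //; exact: unit_interval0.
Qed.

Lemma homotopic_on_eq (S T : topologicalType) (A : set S) (B : set T) f g f' g' :
  (forall x, A x -> f x = f' x) -> (forall x, A x -> g x = g' x) ->
  homotopic_on R A B f g -> homotopic_on R A B f' g'.
Proof.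
move=> ff gg [H [cH HB H01]]; exists H; split=> // x Ax.
by rewrite -ff // -gg //; exact: H01.
Qed.

Lemma homotopic_on_sym (S T : topologicalType) (A : set S) (B : set T) f g :
  homotopic_on R A B f g -> homotopic_on R A B g f.
Proof.
have IC (t : R) : I t -> I (1 - t) by rewrite /unit_interval /=; lra.
move=> [H [/within_homotopyP cH HB H01]].
exists (fun z => H (z.1, 1 - z.2)); split.
- apply/within_homotopyP => x t Ax It W /= HW.
  have [U [d [nU d0 UW]]] := cH x (1 - t) Ax (IC _ It) W HW.
  exists U, d; split=> // y s Uy Ay Is st; apply: UW => //; first exact: IC.
  rewrite (_ : 1 - s - (1 - t) = - (s - t)) ?normrN //; ring.
- by move=> x t Ax It; apply: HB => //; exact: IC.
- by move=> x Ax /=; rewrite subr0 subrr; have [] := H01 x Ax.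
Qed.

Lemma homotopic_on_trans (S T : topologicalType) (A : set S) (B : set T) f g h :
  homotopic_on R A B f g -> homotopic_on R A B g h -> homotopic_on R A B f h.
Proof.
move=> [H [/within_homotopyP cH HB H01]] [K [/within_homotopyP cK KB K01]].
pose L (z : S * R) :=
  if z.2 <= 2^-1 then H (z.1, 2 * z.2) else K (z.1, 2 * z.2 - 1).
have IH (t : R) : I t -> t <= 2^-1 -> I (2 * t) by rewrite /unit_interval /=; lra.
have IK (t : R) : I t -> 2^-1 <= t -> I (2 * t - 1).
  by rewrite /unit_interval /=; lra.
have LK x t : A x -> 2^-1 <= t -> L (x, t) = K (x, 2 * t - 1).
  rewrite /L /= => Ax; rewrite le_eqVlt => /predU1P[<-|].
    rewrite lexx divff // subrr.
    by rewrite (H01 x Ax).2 (K01 x Ax).1.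
  by rewrite ltNge => /negbTE ->.
exists L; split.
- apply/within_homotopyP => x t Ax It W LW.
  (* Each half only controls its own times [s]. If [t] lies strictly on the other side, a small [d]
     makes the request vacuous; at [t = 1/2] both formulas for [L] agree by [LK]. *)
  have [U [d [nU d0 UW]]] : exists U d, [/\ nbhs x U, 0 < d & forall y s, U y ->
      A y -> I s -> `|s - t| < d -> s <= 2^-1 -> W (L (y, s))].
    have [t2|t2] := lerP t 2^-1; last first.
      exists setT, (t - 2^-1); split; [exact: filterT | by rewrite subr_gt0 |].
      by move=> y s _ _ _; rewrite ltr_norml; lra.
    move: LW; rewrite /L /= t2 => LW.
    have [U [d [nU d0 UW]]] := cH x _ Ax (IH _ It t2) W LW.
    exists U, (d / 2); split=> //; first by lra.
    move=> y s Uy Ay Is st s2; rewrite s2; apply: UW => //; first exact: IH.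
    by move: st; rewrite !ltr_norml; lra.
  have [U' [d' [nU' d'0 UW']]] : exists U d, [/\ nbhs x U, 0 < d & forall y s,
      U y -> A y -> I s -> `|s - t| < d -> 2^-1 <= s -> W (L (y, s))].
    have [t2|t2] := lerP (2^-1) t; last first.
      exists setT, (2^-1 - t); split; [exact: filterT | by rewrite subr_gt0 |].
      by move=> y s _ _ _; rewrite ltr_norml; lra.
    move: LW; rewrite (LK _ _ Ax t2) => LW.
    have [U1 [d1 [nU1 d10 UW1]]] := cK x _ Ax (IK _ It t2) W LW.
    exists U1, (d1 / 2); split=> //; first by lra.
    move=> y s Uy Ay Is st s2; rewrite LK //; apply: UW1 => //; first exact: IK.
    by move: st; rewrite !ltr_norml; lra.
  exists (U `&` U'), (Num.min d d'); split.
  + exact: filterI.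
  + by rewrite lt_min d0.
  + move=> y s [Uy U'y] Ay Is; rewrite lt_min => /andP[sd sd'].
    by have [s2|/ltW s2] := lerP s 2^-1; [exact: UW | exact: UW'].
- move=> x t Ax It; rewrite /L /=; case: (lerP t 2^-1) => [t2|/ltW t2].
    by apply: HB => //; exact: IH.
  by apply: KB => //; exact: IK.
- move=> x Ax; split.
    by rewrite /L /= invr_ge0 ler0n mulr0 (H01 x Ax).1.
  rewrite LK //; last lra.
  by rewrite (_ : 2 * 1 - 1 = 1) ?(K01 x Ax).2 //; ring.
Qed.

Lemma homotopic_on_precomp (S' S T : topologicalType) (A' : set S') (A : set S)
    (B : set T) f g (p : S' -> S) :
  {within A', continuous p} -> (forall x, A' x -> A (p x)) ->
  homotopic_on R A B f g -> homotopic_on R A' B (f \o p) (g \o p).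
Proof.
move=> /within_continuousP cp pA [H [/within_homotopyP cH HB H01]].
exists (fun z => H (p z.1, z.2)); split.
- apply/within_homotopyP => x t Ax It W /= HW.
  have [U [d [nU d0 UW]]] := cH (p x) t (pA _ Ax) It W HW.
  exists [set y | A' y -> U (p y)], d; split=> //; first exact: cp.
  by move=> y s Uy Ay Is st; apply: UW => //; [exact: Uy | exact: pA].
- by move=> x t /pA; exact: HB.
- by move=> x /pA; exact: H01.
Qed.

Lemma homotopic_on_postcomp (S T T' : topologicalType) (A : set S)
    (B : set T) (B' : set T') f g (p : T -> T') :
  {within B, continuous p} -> (forall x, B x -> B' (p x)) ->
  homotopic_on R A B f g -> homotopic_on R A B' (p \o f) (p \o g).
Proof.
move=> /within_continuousP cp pB [H [/within_homotopyP cH HB H01]].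
exists (fun z => p (H z)); split.
- apply/within_homotopyP => x t Ax It W /= HW.
  have [U [d [nU d0 UW]]] := cH x t Ax It _ (cp _ (HB _ _ Ax It) _ HW).
  exists U, d; split=> // y s Uy Ay Is st; apply: UW => //; exact: HB.
- by move=> x t Ax It; apply: pB; exact: HB.
- by move=> x /H01 [/= -> ->].
Qed.

Lemma homotopic_on_chain (S T : topologicalType) (A : set S) (B : set T)
    (f : nat -> S -> T) :
  (forall i, homotopic_on R A B (f i) (f i.+1)) ->
  forall i, homotopic_on R A B (f 0) (f i).
Proof.
move=> ff; elim=> [|i IH]; last exact: homotopic_on_trans IH (ff i).
exact: homotopic_on_trans (ff 0) (homotopic_on_sym (ff 0)).
Qed.

End Homotopy.

(** * Maps between finite approximations *)

Section Alexandrov.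
Context {R : realType}.
Notation I := (unit_interval R).

Definition mono_on (S T : Type) (A : set (alex S)) (f : alex S -> alex T) :=
  forall C D, A C -> A D -> C `<=` D -> f C `<=` f D.

Lemma alex_nbhsP (T : Type) (C : alex T) (P : set (alex T)) :
  nbhs C P <-> forall D : set T, D `<=` C -> P D.
Proof.
split=> [|CP]; rewrite nbhsE /=.
  by move=> [B [oB BC] BP] D DC; apply: BP; exact: oB BC DC.
exists [set D : alex T | D `<=` C] => //; split=> //.
by move=> D E /= DC ED; exact: subset_trans DC.
Qed.

Lemma within_alexP (S T : Type) (A : set (alex S)) (f : alex S -> alex T) :
  {within A, continuous f} <-> mono_on A f.
Proof.
rewrite within_continuousP; split=> [cf C D AC AD CD | mf C AC W /alex_nbhsP fW].
  have /(cf D AD) : nbhs (f D) [set E : alex T | E `<=` f D] by apply/alex_nbhsP.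
  by move/alex_nbhsP => /(_ C CD AC).
by apply/alex_nbhsP => D DC AD /=; apply: fW; exact: mf.
Qed.

(** Continuity tested on the least neighbourhood of [H (C, t)]. Letting [D] shrink as well allows
    singletons to be compared with a pair containing them. *)
Lemma alex_homotopy_usc (S T : Type) (A : set (alex S)) (H : alex S * R -> alex T)
    C t : {within A `*` I, continuous H} -> A C -> I t ->
  exists d, 0 < d /\ forall D s, D `<=` C -> A D -> I s -> `|s - t| < d ->
    H (D, s) `<=` H (C, t).
Proof.
move=> /within_homotopyP cH AC It.
have HW : nbhs (H (C, t)) [set E : alex T | E `<=` H (C, t)] by apply/alex_nbhsP.
have [U [d [/alex_nbhsP nU d0 UW]]] := cH C t AC It _ HW.
by exists d; split=> // D s DC AD Is st; apply: UW => //; exact: nU.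
Qed.

Lemma homotopic_on_mono (S T : Type) (A : set (alex S)) (B : set (alex T))
    (f g : alex S -> alex T) : homotopic_on R A B f g -> mono_on A f.
Proof.
move=> [H [cH _ H01]] C D AC AD CD; have I0 := @unit_interval0 R.
have [d [d0 dH]] := alex_homotopy_usc cH AD I0.
by rewrite -(H01 C AC).1 -(H01 D AD).1; apply: dH; rewrite // subrr normr0.
Qed.

(** The homotopy jumps at [t = 1]. The larger map has to sit on the closed piece, since open sets
    are down-sets: nearby values may be smaller, not larger. *)
Lemma homotopic_on_le (S T : Type) (A : set (alex S)) (B : set (alex T))
    (f g : alex S -> alex T) : mono_on A f -> mono_on A g ->
  (forall C, A C -> B (f C)) -> (forall C, A C -> B (g C)) ->
  (forall C, A C -> f C `<=` g C) -> homotopic_on R A B f g.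
Proof.
move=> mf mg fB gB fg; exists (fun z => if z.2 < 1 then f z.1 else g z.1); split.
- apply/within_homotopyP => C t AC It W /=; case: ltP => t1 /alex_nbhsP fW.
    exists [set D : alex S | D `<=` C], (1 - t); split; [exact/alex_nbhsP | lra |].
    move=> D s DC AD Is st; rewrite ifT; first by apply: fW; exact: mf.
    by move: st; rewrite ltr_norml; lra.
  exists [set D : alex S | D `<=` C], 1; split=> //; first exact/alex_nbhsP.
  move=> D s DC AD Is _; apply: fW; case: ifP => _; last exact: mg.
  by apply: subset_trans (fg _ AC); exact: mf.
- by move=> C t AC It /=; case: ifP => _; [exact: fB | exact: gB].
- by move=> C AC /=; rewrite ltr01 ltxx.
Qed.

Lemma homotopic_on_setU (S T : Type) (A : set (alex S)) (B : set (alex T))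
    (f g : alex S -> alex T) : mono_on A f -> mono_on A g ->
  (forall C, A C -> B (f C)) -> (forall C, A C -> B (g C)) ->
  (forall C, A C -> B (f C `|` g C)) -> homotopic_on R A B f g.
Proof.
move=> mf mg fB gB fgB.
have mfg : mono_on A (fun C => f C `|` g C : alex T).
  by move=> C D AC AD CD; apply: setUSS; [exact: mf | exact: mg].
apply: (@homotopic_on_trans _ _ _ _ _ _ (fun C => f C `|` g C : alex T)).
  by apply: homotopic_on_le => // C AC; exact: subsetUl.
by apply/homotopic_on_sym/homotopic_on_le => // C AC; exact: subsetUr.
Qed.

End Alexandrov.

Lemma finite_uniform_pos {R : realType} (T : choiceType) (A : set T)
    (P : T -> R -> Prop) : finite_set A ->
  (forall a d d', P a d -> d' <= d -> P a d') ->
  (forall a, A a -> exists d, 0 < d /\ P a d) ->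
  exists d, 0 < d /\ forall a, A a -> P a d.
Proof.
move=> /finite_seqP[s ->] Pd; elim: s => [|a s IH] AP.
  by exists 1; split=> // a; rewrite /= in_nil.
have [d [d0 dP]] : exists d, 0 < d /\ forall a, [set` s] a -> P a d.
  by apply: IH => b bs; apply: AP; rewrite /= inE bs orbT.
have [d' [d'0 d'P]] : exists d, 0 < d /\ P a d by apply: AP; rewrite /= inE eqxx.
exists (Num.min d d'); split; first by rewrite lt_min d0.
move=> b /=; rewrite inE => /predU1P[->|bs].
  by apply: Pd d'P _; rewrite ge_min lexx orbT.
by apply: Pd (dP b bs) _; rewrite ge_min lexx.
Qed.

(** * Levels and bonding maps of one finite approximation *)

Section FiniteApproximation.
Context {R : realType} {X : metricType R}.
Variables (eps : nat -> R) (A : nat -> set X).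
Hypothesis hT : finite_approx eps A.

Lemma eps_gt0 n : 0 < eps n. Proof. by case: hT. Qed.

Lemma eps_half n : eps n.+1 < eps n / 2. Proof. by case: hT. Qed.

Lemma eps_decr n k : eps (n + k) <= eps n.
Proof.
elim: k => [|k IH]; first by rewrite addn0.
by rewrite addnS; have := eps_half (n + k); have := eps_gt0 (n + k); lra.
Qed.

Lemma eps_le n m : (n <= m)%N -> eps m <= eps n.
Proof. by move=> nm; rewrite -(subnKC nm); exact: eps_decr. Qed.

Lemma eps_small e : 0 < e -> exists n, forall m, (n <= m)%N -> eps m < e.
Proof.
(* Halving implies decay at least like [1 / n.+1], which suffices and avoids powers of two. *)
move=> e0; have bnd n : eps n * n.+1%:R <= eps 0.
  elim: n => [|n IH]; first by rewrite mulr1.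
  apply: le_trans IH; have := eps_half n; have := eps_gt0 n.
  rewrite -(natr1 n.+1) -(natr1 n); have : 0 <= n%:R :> R by [].
  by move: (n%:R : R) => x; nra.
have e00 := eps_gt0 0; exists (Num.truncn (eps 0 / e)) => m Nm.
rewrite ltNge; apply/negP => em.
have : eps 0 / e < m.+1%:R.
  apply: lt_le_trans (Num.Theory.truncnS_gt _) _.
  by rewrite ler_nat ltnS.
rewrite ltr_pdivrMr // mulrC => lt0; have := bnd m.
suff : e * m.+1%:R <= eps m * m.+1%:R by lra.
by rewrite ler_wpM2r.
Qed.

Lemma eps_near n x : exists a, A n a /\ mdist x a < eps n.
Proof. by case: hT => _ _ /(_ n)[_]; exact. Qed.

Lemma lvl_setU n (C D : set X) : lvl eps A n C -> lvl eps A n D ->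
  (forall c d, C c -> D d -> mdist c d < 4 * eps n) -> lvl eps A n (C `|` D).
Proof.
move=> [[c Cc] CA Cd] [_ DA Dd] CD; split.
- by exists c; left.
- by rewrite subUset.
- by move=> a b [Ca|Da] [Cb|Db];
    [exact: Cd | exact: CD | rewrite metric_sym; exact: CD | exact: Dd].
Qed.

Lemma bond_mono n (C D : set X) : C `<=` D -> bond eps A n C `<=` bond eps A n D.
Proof. by move=> CD a [Aa [c [Cc ca]]]; split=> //; exists c; split=> //; exact: CD. Qed.

(** Pairwise distances grow by less than [2 * eps n], and [4 * eps n.+1 < 2 * eps n]. *)
Lemma bond_lvl n C : lvl eps A n.+1 C -> lvl eps A n (bond eps A n C).
Proof.
move=> [[c Cc] CA Cd]; have [a [Aa ca]] := eps_near n c; split.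
- by exists a; split=> //; exists c.
- by move=> b [].
- move=> b b' [_ [c1 [Cc1 cb]]] [_ [c2 [Cc2 cb']]].
  have := Cd _ _ Cc1 Cc2; have := eps_half n.
  have := metric_triangle b c1 b'; have := metric_triangle c1 c2 b'.
  by rewrite (metric_sym b c1); lra.
Qed.

Lemma bondk_mono n k (C D : set X) :
  C `<=` D -> bondk eps A n k C `<=` bondk eps A n k D.
Proof. by elim: k C D => //= k IH C D CD; apply: IH; exact: bond_mono. Qed.

Lemma bondk_lvl n k C : lvl eps A (n + k) C -> lvl eps A n (bondk eps A n k C).
Proof.
elim: k C => [|k IH] C /=; first by rewrite addn0.
by rewrite addnS => LC; apply: IH; exact: bond_lvl.
Qed.

Lemma bondk_add n k l C :
  bondk eps A n (k + l) C = bondk eps A n k (bondk eps A (n + k) l C).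
Proof.
by elim: l C => [|l IH] C; rewrite ?addn0 // addnS /= IH addnA.
Qed.

(* [eps_j <= 2 (eps_j - eps_(j+1))], so the drift along the bonding maps
   telescopes; the slack [2 eps_(n+k)] absorbs points close to [C]. *)
Lemma bondk_near n k (C : set X) a : bondk eps A n k C a ->
  exists c, C c /\ mdist c a <= 2 * (eps n - eps (n + k)).
Proof.
elim: k C => [|k IH] C /=.
  by rewrite addn0 subrr mulr0 => Ca; exists a; rewrite mdistxx.
move=> /IH[c [[_ [c' [Cc' cc']]] ca]]; exists c'; split=> //.
have := metric_triangle c' c a; have := eps_half (n + k).
by rewrite addnS; lra.
Qed.

Lemma bondnm_mono n m (C D : set X) :
  C `<=` D -> bondnm eps A n m C `<=` bondnm eps A n m D.
Proof. exact: bondk_mono. Qed.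

Lemma bondnm_lvl n m C : (n <= m)%N ->
  lvl eps A m C -> lvl eps A n (bondnm eps A n m C).
Proof. by move=> nm LC; apply: bondk_lvl; rewrite subnKC. Qed.

Lemma bondnm_trans n p m C : (n <= p)%N -> (p <= m)%N ->
  bondnm eps A n m C = bondnm eps A n p (bondnm eps A p m C).
Proof.
move=> np pm; rewrite /bondnm -{2}(subnKC np) -bondk_add.
by congr (bondk _ _ _ _ _); lia.
Qed.

Lemma bondnm_near n m (C : set X) a : (n <= m)%N -> bondnm eps A n m C a ->
  exists c, C c /\ mdist c a <= 2 * (eps n - eps m).
Proof. by move=> nm /bondk_near; rewrite subnKC. Qed.

Lemma lvl_sub n C : lvl eps A n C -> C `<=` A n. Proof. by case. Qed.

Lemma lvl_mdist n C a b : lvl eps A n C -> C a -> C b -> mdist a b < 4 * eps n.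
Proof. by case=> _ _; exact. Qed.

Lemma lvl_neq0 n C : lvl eps A n C -> C !=set0. Proof. by case. Qed.

Lemma lvl_set1 n a : A n a -> lvl eps A n [set a].
Proof.
move=> Aa; split; [by exists a | by move=> _ -> |].
by move=> _ _ -> ->; rewrite mdistxx; have := eps_gt0 n; lra.
Qed.

Lemma lvl_set2 n a b : A n a -> A n b -> mdist a b < 4 * eps n ->
  lvl eps A n [set a; b].
Proof.
by move=> Aa Ab ab; apply: lvl_setU;
  [exact: lvl_set1 | exact: lvl_set1 | move=> _ _ -> ->].
Qed.

End FiniteApproximation.

(** * Pro-morphisms of finite approximations and proximate sequences *)

Section FiniteModel.
Context {R : realType} {X Y : metricType R}.
Variables (epsX : nat -> R) (AX : nat -> set X).
Variables (epsY : nat -> R) (AY : nat -> set Y).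
Hypothesis hX : finite_approx epsX AX.
Hypothesis hY : finite_approx epsY AY.
Notation I := (unit_interval R).
Notation lvlX := (lvl epsX AX).
Notation lvlY := (lvl epsY AY).

(** For points less than [2 * eta] apart, the sets [C] and [C'] have a union of diameter below
    [2 * (2 * epsX p - eta) + 2 * eta], that is [4 * epsX p]; by monotonicity both selected values
    lie in the image of this union. *)
Lemma selection_contig p n (F : alex X -> alex Y) (g h : X -> Y) eta :
  mono_on (lvlX p) F -> (forall C, lvlX p C -> lvlY n (F C)) ->
  (forall k, k = g \/ k = h -> forall x, exists C : set X, [/\ C !=set0,
    C `<=` AX p, forall c, C c -> mdist x c <= 2 * epsX p - eta & F C (k x)]) ->
  0 < eta -> contig (2 * eta) (4 * epsY n) g h.
Proof.
move=> mF FB sel eta0.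
suff key k k' x x' : k = g \/ k = h -> k' = g \/ k' = h ->
    mdist x x' < 2 * eta -> mdist (k x) (k' x') < 4 * epsY n.
  by move=> x x' xx'; split; apply: key; rewrite //; by [left|right].
move=> kgh kgh' xx'; have [C [C0 CA Cx FC]] := sel _ kgh x.
have [C' [C'0 C'A C'x FC']] := sel _ kgh' x'.
have ball2 z z' c c' : mdist z z' < 2 * eta -> mdist z c <= 2 * epsX p - eta ->
    mdist z' c' <= 2 * epsX p - eta -> mdist c c' < 4 * epsX p.
  have := metric_triangle c z c'; have := metric_triangle z z' c'.
  by rewrite (metric_sym c z); lra.
have LC : lvlX p C.
  split=> // a b /Cx xa /Cx xb; apply: ball2 xa xb; rewrite mdistxx; lra.
have LC' : lvlX p C'.
  split=> // a b /C'x xa /C'x xb; apply: ball2 xa xb; rewrite mdistxx; lra.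
have LU : lvlX p (C `|` C').
  by apply: lvl_setU => // a b /Cx xa /C'x xb; exact: ball2 xx' xa xb.
apply: (lvl_mdist (FB _ LU)).
  by apply: (mF _ _ LC LU _ _ FC); exact: subsetUl.
by apply: (mF _ _ LC' LU _ _ FC'); exact: subsetUr.
Qed.

(** At each time [t] a point of [H ([set a x], t)] is selected, and [interval_chain] joins the
    selections at [0] and [1]. [ends] compares these with [g] and [h], whose net points may differ
    from [a x]. *)
Lemma homotopic_selection_linked m n (F G : alex X -> alex Y) (g h : X -> Y) :
  homotopic_on R (lvlX m) (lvlY n) F G ->
  (forall x, exists a, [/\ AX m a, mdist x a < epsX m & F [set a] (g x)]) ->
  (forall x, exists a, [/\ AX m a, mdist x a < epsX m & G [set a] (h x)]) ->
  linked (4 * epsY n) g h.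
Proof.
move=> HFG gF hG; have HGF := homotopic_on_sym HFG.
have [H [cH HB H01]] := HFG; have em := eps_gt0 hX m.
have [a aP] := choice (eps_near hX m).
have ends (K K' : alex X -> alex Y) k k' : homotopic_on R (lvlX m) (lvlY n) K K' ->
    (forall x, exists a, [/\ AX m a, mdist x a < epsX m & K [set a] (k x)]) ->
    (forall x, K [set a x] (k' x)) -> linked (4 * epsY n) k k'.
  move=> KK' kK k'K; apply: (@contig_linked _ _ _ (2 * epsX m)); first lra.
  have := @selection_contig m n K k k' (epsX m); apply => //;
    [exact: homotopic_on_mono KK' | exact: homotopic_on_in KK' |].
  move=> l [->|->] x.
    have [b [Ab xb Kb]] := kK x; exists [set b]; split=> //; first by exists b.
      by move=> _ ->.
    by move=> _ ->; lra.
  have [Aa xa] := aP x; exists [set a x]; split=> //; first by exists (a x).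
    by move=> _ ->.
  by move=> _ ->; lra.
have /choice[k kP] (z : R * X) :
    exists y, I z.1 -> (H ([set a z.2], z.1) : set Y) y.
  case: z => t x /=; have [It|nIt] := pselect (I t); last by exists (g x).
  have [y Hy] := lvl_neq0 (HB _ _ (lvl_set1 hX (aP x).1) It).
  by exists y.
have I0 := @unit_interval0 R; have I1 := @unit_interval1 R.
have L1 x := lvl_set1 hX (aP x).1.
apply: (@linked_trans _ _ _ _ _ (fun x => k (0, x))).
  apply: ends HFG gF _ => x; rewrite -(H01 _ (L1 x)).1; exact: (kP (0, x)).
apply: (@linked_trans _ _ _ _ _ (fun x => k (1, x))); last first.
  apply/linked_sym/(ends _ _ _ _ HGF hG) => x.
  rewrite -(H01 _ (L1 x)).2; exact: (kP (1, x)).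
apply: (@interval_chain _ _ (linked (4 * epsY n)) (fun t x => k (t, x))).
- exact: linked_sym.
- exact: linked_trans.
move=> t It.
(* One [d] serves all pairs of net points because there are finitely many. The value at the pair, at
   time [t], then contains every selected value to be compared. *)
have [d [d0 dH]] : exists d, 0 < d /\ forall z, (AX m `*` AX m) z ->
    mdist z.1 z.2 < 4 * epsX m -> forall D s, D `<=` [set z.1; z.2] ->
    lvlX m D -> I s -> `|s - t| < d -> H (D, s) `<=` H ([set z.1; z.2], t).
  apply: (@finite_uniform_pos R (X * X)%type (AX m `*` AX m) (fun z d =>
    mdist z.1 z.2 < 4 * epsX m -> forall D s, D `<=` [set z.1; z.2] ->
    lvlX m D -> I s -> `|s - t| < d -> H (D, s) `<=` H ([set z.1; z.2], t))).
  - by apply: finite_setX; case: hX => _ _ /(_ m)[].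
  - move=> z d d' Hd dd' zz D s Dz LD Is sd; apply: Hd => //.
    exact: lt_le_trans dd'.
  - move=> [b c] [/= Ab Ac]; have [bc|bc] := ltP (mdist b c) (4 * epsX m).
      have [d [d0 dP]] := alex_homotopy_usc cH (lvl_set2 hX Ab Ac bc) It.
      by exists d; split.
    by exists 1; split.
exists d; split=> // s Is st; apply: (@contig_linked _ _ _ (2 * epsX m)); first lra.
move=> x x' xx'; have [[Ax xa] [Ax' xa']] := (aP x, aP x').
have aa' : mdist (a x) (a x') < 4 * epsX m.
  have := metric_triangle (a x) x (a x'); have := metric_triangle x x' (a x').
  by rewrite (metric_sym (a x) x); lra.
have sub u y : u = s \/ u = t -> y = x \/ y = x' ->
    H ([set a x; a x'], t) (k (u, y)).
  move=> us yx; have [Iu ut] : I u /\ `|u - t| < d.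
    by case: us => ->; rewrite // subrr normr0.
  have := kP (u, y) Iu; apply: (dH (a x, a x')) => //=.
  by case: yx => -> b ->; [left|right].
by split; apply: (lvl_mdist (HB _ _ (lvl_set2 hX Ax Ax' aa') It));
  apply: sub; auto.
Qed.

Definition thick (h : X -> Y) n : alex X -> alex Y :=
  fun C => [set b | AY n b /\ exists c, C c /\ mdist (h c) b < epsY n].

Lemma thickS h n (C D : set X) : C `<=` D -> thick h n C `<=` thick h n D.
Proof.
by move=> CD b [Ab [c [Cc cb]]]; split=> //; exists c; split=> //; exact: CD.
Qed.

Lemma thick_mono h n B : mono_on B (thick h n).
Proof. by move=> C D _ _; exact: thickS. Qed.

(** Points of the union are less than [epsY n + epsY n / 2 + epsY n] apart. *)
Lemma thick_setU_lvl d h h' m n C : contig d (epsY n / 2) h h' ->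
  4 * epsX m <= d -> lvlX m C -> lvlY n (thick h n C `|` thick h' n C).
Proof.
move=> hh' md LC; have en := eps_gt0 hY n; split.
- have [c Cc] := lvl_neq0 LC; have [b [Ab cb]] := eps_near hY n (h c).
  by exists b; left; split=> //; exists c.
- by move=> b [[]|[]].
- have key k k' b b' : k = h \/ k = h' -> k' = h \/ k' = h' ->
      thick k n C b -> thick k' n C b' -> mdist b b' < 4 * epsY n.
    move=> kh kh' [_ [c [Cc cb]]] [_ [c' [Cc' cb']]].
    have : mdist (k c) (k' c') < epsY n / 2.
      have cc' : mdist c c' < d := lt_le_trans (lvl_mdist LC Cc Cc') md.
      have [? ? ?] := hh' _ _ cc'; have [? ? ?] := contig_sym hh' cc'.
      by case: kh => ->; case: kh' => ->.
    have := metric_triangle b (k c) b'; have := metric_triangle (k c) (k' c') b'.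
    by rewrite (metric_sym b (k c)); lra.
  by move=> b b' [hb|hb] [hb'|hb']; apply: (key _ _ _ _ _ _ hb hb'); auto.
Qed.

Lemma thick_lvl d h m n C : contig d (epsY n / 2) h h ->
  4 * epsX m <= d -> lvlX m C -> lvlY n (thick h n C).
Proof. by move=> hh md /(thick_setU_lvl hh md); rewrite setUid. Qed.

Lemma thick_homotopic d h h' m n : chained d (epsY n / 2) h h' ->
  4 * epsX m <= d -> homotopic_on R (lvlX m) (lvlY n) (thick h n) (thick h' n).
Proof.
move=> [p [l [<- pl pc]]] md; rewrite -(pl l) //.
apply: (@homotopic_on_chain _ _ _ _ _ (fun i => thick (p i) n)) => i.
apply: homotopic_on_setU; [exact: thick_mono | exact: thick_mono | | |] => C LC.
- exact: (thick_lvl (contig_refl (pc i)) md LC).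
- exact: (thick_lvl (contig_refl (pc i.+1)) md LC).
- exact: (thick_setU_lvl (pc i) md LC).
Qed.

(** The constant [3] is what the level allows: with the error below [epsY n] of [thick], the union
    stays under diameter [4 * epsY n]. *)
Lemma thick_near_homotopic d h m n (F : alex X -> alex Y) :
  mono_on (lvlX m) F -> (forall C, lvlX m C -> lvlY n (F C)) ->
  contig d (epsY n / 2) h h -> 4 * epsX m <= d ->
  (forall C b c, lvlX m C -> F C b -> C c -> mdist (h c) b <= 3 * epsY n) ->
  homotopic_on R (lvlX m) (lvlY n) F (thick h n).
Proof.
move=> mF FB hh md Fh; apply: homotopic_on_setU => //; first exact: thick_mono.
  by move=> C; exact: (thick_lvl hh md).
move=> C LC; apply: lvl_setU; [exact: FB | exact: (thick_lvl hh md LC) |].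
move=> b b' FCb [_ [c [Cc cb']]]; have := Fh _ _ _ LC FCb Cc.
by have := metric_triangle b (h c) b'; rewrite (metric_sym b (h c)); lra.
Qed.

Definition fin_sel (r : (nat -> nat) * (nat -> alex X -> alex Y))
    (g : nat -> X -> Y) :=
  forall n x, exists a,
    [/\ AX (r.1 n) a, mdist x a < epsX (r.1 n) & r.2 n [set a] (g n x)].

Lemma pro_rep_mono r n : pro_rep epsX AX epsY AY r -> mono_on (lvlX (r.1 n)) (r.2 n).
Proof. by move=> [_ /(_ n)[/within_alexP]]. Qed.

Lemma pro_rep_lvl r n C : pro_rep epsX AX epsY AY r ->
  lvlX (r.1 n) C -> lvlY n (r.2 n C).
Proof. by move=> [_ /(_ n)[_ rB] _]; exact: rB. Qed.

Lemma fin_sel_exists r : pro_rep epsX AX epsY AY r -> exists g, fin_sel r g.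
Proof.
move=> Pr; have /choice[g gP] (z : nat * X) : exists y, exists a,
    [/\ AX (r.1 z.1) a, mdist z.2 a < epsX (r.1 z.1) & (r.2 z.1 [set a] : set Y) y].
  case: z => n x /=; have [a [Aa xa]] := eps_near hX (r.1 n) x.
  have [y ry] := lvl_neq0 (pro_rep_lvl Pr (lvl_set1 hX Aa)).
  by exists y, a.
by exists (fun n x => g (n, x)) => n x; exact: (gP (n, x)).
Qed.

(** With [p = r.1 n], the bonded singleton lies within [epsX m + 2 * (epsX p - epsX m)] of [x]. This
    is [2 * epsX p - epsX m], so [selection_contig] applies with [eta = epsX m]. *)
Lemma fin_sel_bond r g n m k : pro_rep epsX AX epsY AY r -> fin_sel r g ->
  (r.1 n <= m)%N ->
  (forall x, exists a, [/\ AX m a, mdist x a < epsX m &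
     r.2 n (bondnm epsX AX (r.1 n) m [set a]) (k x)]) ->
  linked (4 * epsY n) (g n) k.
Proof.
move=> Pr gr nm kr; have em := eps_gt0 hX m.
apply: (@contig_linked _ _ _ (2 * epsX m)); first lra.
apply: (@selection_contig (r.1 n) n (r.2 n)) em; first exact: pro_rep_mono.
  by move=> C; exact: pro_rep_lvl.
have le := eps_le hX nm.
move=> l [->|->] x.
  have [a [Aa xa ra]] := gr n x; exists [set a]; split=> //; first by exists a.
    by move=> _ ->.
  by move=> _ ->; lra.
have [a [Aa xa ra]] := kr x; have LC := bondnm_lvl hX nm (lvl_set1 hX Aa).
exists (bondnm epsX AX (r.1 n) m [set a]); split=> //.
- exact: lvl_neq0 LC.
- exact: lvl_sub LC.
move=> c /(bondnm_near hX nm)[_ [-> ac]].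
by have := metric_triangle x a c; lra.
Qed.

(** Two selections interpolate: [l] from [r.2 n] after the bonding map of [X], and [k] from the
    bonding map of [Y] after [r.2 n.+1]. The homotopy of the square links them; [k] is near [g n.+1]
    because that bonding map moves points by less than [epsY n]. *)
Lemma fin_sel_prox r g : pro_rep epsX AX epsY AY r -> fin_sel r g -> prox g.
Proof.
move=> Pr gr e e0; have e4 : 0 < e / 4 by lra.
have [n0 small] := eps_small hY e4; exists n0 => n n0n.
apply: (@linked_le _ _ _ (4 * epsY n)); first by have := small n n0n; lra.
have [rh rc rH] := Pr; have ph := rh _ _ (leqnSn n).
set m := r.1 n.+1 in ph *.
have [a aP] := choice (gr n.+1).
have La x : lvlX m [set a x] by apply: (lvl_set1 hX); have [] := aP x.
have /choice[k kP] x : exists y, (bond epsY AY n (r.2 n.+1 [set a x]) : set Y) y.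
  by have [y] := lvl_neq0 (bond_lvl hY (pro_rep_lvl Pr (La x))); exists y.
have /choice[l lP] x : exists y,
    (r.2 n (bondnm epsX AX (r.1 n) m [set a x]) : set Y) y.
  by have [y] := lvl_neq0 (pro_rep_lvl Pr (bondnm_lvl hX ph (La x))); exists y.
apply: (@linked_trans _ _ _ _ _ l).
  apply: (fin_sel_bond Pr gr ph) => x; have [? ? _] := aP x.
  by exists (a x).
apply: (@linked_trans _ _ _ _ _ k).
  apply: linked_sym; apply: (homotopic_selection_linked (rH n)) => x.
    by have [? ? _] := aP x; exists (a x); split=> //; exact: kP.
  by have [? ? _] := aP x; exists (a x); split=> //; exact: lP.
have em := eps_gt0 hX m; apply: (@contig_linked _ _ _ (2 * epsX m)); first lra.
have en := eps_half hY n; move=> x x' xx'.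
have [[Ax xa ra] [Ax' xa' ra']] := (aP x, aP x').
have aa' : mdist (a x) (a x') < 4 * epsX m.
  have := metric_triangle (a x) x (a x'); have := metric_triangle x x' (a x').
  by rewrite (metric_sym (a x) x); lra.
have L2 := lvl_set2 hX Ax Ax' aa'; have E := pro_rep_lvl Pr L2.
have sub y : y = x \/ y = x' -> r.2 n.+1 [set a y] `<=` r.2 n.+1 [set a x; a x'].
  by move=> yx; apply: (pro_rep_mono Pr (La y) L2) => b ->; case: yx => ->; [left|right].
have near y : y = x \/ y = x' ->
    exists z, r.2 n.+1 [set a x; a x'] z /\ mdist z (k y) < epsY n.
  by move=> yx; have [_ [z [rz zk]]] := kP y; exists z; split=> //; exact: sub rz.
have g1 : r.2 n.+1 [set a x; a x'] (g n.+1 x) by apply: sub ra; left.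
have g2 : r.2 n.+1 [set a x; a x'] (g n.+1 x') by apply: sub ra'; right.
have [z [rz zk]] := near x (or_introl erefl).
have [z' [rz' zk']] := near x' (or_intror erefl).
split.
- have := lvl_mdist E rz rz'; have := metric_triangle (k x) z (k x').
  by have := metric_triangle z z' (k x'); rewrite (metric_sym (k x) z); lra.
- by have := lvl_mdist E g1 g2; have := eps_gt0 hY n; lra.
- have := lvl_mdist E rz g2; have := metric_triangle (k x) z (g n.+1 x').
  by rewrite (metric_sym (k x) z); have := eps_gt0 hY n; lra.
Qed.

Lemma pro_equiv_linked r s g h : pro_rep epsX AX epsY AY r ->
  pro_rep epsX AX epsY AY s -> fin_sel r g -> fin_sel s h ->
  pro_equiv epsX AX epsY AY r s -> prox_equiv g h.
Proof.
move=> Pr Ps gr hs rs e e0; have e4 : 0 < e / 4 by lra.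
have [n0 small] := eps_small hY e4; exists n0 => n n0n.
apply: (@linked_le _ _ _ (4 * epsY n)); first by have := small n n0n; lra.
have [m [rm sm H]] := rs n; have [a aP] := choice (eps_near hX m).
have sel q (Pq : pro_rep epsX AX epsY AY q) : (q.1 n <= m)%N ->
    exists k : X -> Y, forall x, exists a, [/\ AX m a, mdist x a < epsX m &
      (q.2 n \o bondnm epsX AX (q.1 n) m) [set a] (k x)].
  move=> qm; have /choice[k kP] x : exists y,
      (q.2 n (bondnm epsX AX (q.1 n) m [set a x]) : set Y) y.
    have Lx := lvl_set1 hX (aP x).1.
    by have [y] := lvl_neq0 (pro_rep_lvl Pq (bondnm_lvl hX qm Lx)); exists y.
  by exists k => x; have [? ?] := aP x; exists (a x); split=> //; exact: kP.
have [k kP] := sel r Pr rm; have [l lP] := sel s Ps sm.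
apply: linked_trans (fin_sel_bond Pr gr rm kP) _.
apply: linked_trans (homotopic_selection_linked H kP lP) _.
exact: linked_sym (fin_sel_bond Ps hs sm lP).
Qed.

(** Consecutive squares are pasted: the inductive homotopy is precomposed with a bonding map of [X],
    the new square postcomposed with one of [Y]. *)
Lemma pro_rep_bond r n k : pro_rep epsX AX epsY AY r ->
  homotopic_on R (lvlX (r.1 (n + k)%N)) (lvlY n)
    (r.2 n \o bondnm epsX AX (r.1 n) (r.1 (n + k)%N))
    (bondk epsY AY n k \o r.2 (n + k)%N).
Proof.
move=> Pr; have [rh rc rH] := Pr.
elim: k => [|k IH].
  rewrite addn0; have -> : bondnm epsX AX (r.1 n) (r.1 n) = id.
    by rewrite /bondnm subnn.
  have mr : mono_on (lvlX (r.1 n)) (r.2 n) by exact: pro_rep_mono.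
  apply: homotopic_on_le => //.
  - by move=> C LC; exact: (pro_rep_lvl Pr LC).
  - by move=> C LC; exact: (pro_rep_lvl Pr LC).
  - by move=> C LC b.
rewrite addnS; have le1 : (r.1 n <= r.1 (n + k)%N)%N by apply: rh; lia.
have le2 : (r.1 (n + k)%N <= r.1 (n + k).+1)%N by apply: rh; lia.
pose q := bondnm epsX AX (r.1 (n + k)%N) (r.1 (n + k).+1).
have IHq : homotopic_on R (lvlX (r.1 (n + k).+1)) (lvlY n)
    ((r.2 n \o bondnm epsX AX (r.1 n) (r.1 (n + k)%N)) \o q)
    ((bondk epsY AY n k \o r.2 (n + k)%N) \o q).
  apply: homotopic_on_precomp IH.
    by apply/within_alexP => C D _ _; exact: bondnm_mono.
  by move=> C; exact: bondnm_lvl.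
apply: homotopic_on_trans.
  apply: homotopic_on_eq IHq => [C _ /=|C _]; last reflexivity.
  by rewrite /q -bondnm_trans.
apply/homotopic_on_sym.
apply: (@homotopic_on_postcomp _ _ _ _ _ _ (lvlY n) _ _ (bondk epsY AY n k))
  (rH (n + k)%N).
  by apply/within_alexP => C D _ _; exact: bondk_mono.
by move=> C; exact: (bondk_lvl hY).
Qed.

(** Level [n] alone locates values only up to [4 * epsY n]. At the deeper level [N] the error is
    [4 * epsY N <= epsY n], and bonding back to [n] drifts by less than [2 * epsY n], so the total
    fits the [3 * epsY n] of [thick_near_homotopic]. *)
Lemma fin_sel_thick r g d n k m : pro_rep epsX AX epsY AY r -> fin_sel r g ->
  contig d (epsY n / 2) (g (n + k)%N) (g (n + k)%N) ->
  4 * epsX m <= d -> (r.1 (n + k)%N < m)%N -> 4 * epsY (n + k) <= epsY n ->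
  homotopic_on R (lvlX m) (lvlY n)
    (r.2 n \o bondnm epsX AX (r.1 n) m) (thick (g (n + k)%N) n).
Proof.
move=> Pr gr gg md Nm small; have [rh rc rH] := Pr.
set N := (n + k)%N in gg Nm small *; set p := r.1 N in Nm *.
have np : (r.1 n <= p)%N by apply: rh; rewrite /N; lia.
have pm := ltnW Nm; pose q := bondnm epsX AX p m.
have H1 : homotopic_on R (lvlX m) (lvlY n)
    ((r.2 n \o bondnm epsX AX (r.1 n) p) \o q)
    ((bondk epsY AY n k \o r.2 N) \o q).
  apply: homotopic_on_precomp (pro_rep_bond n k Pr).
    by apply/within_alexP => C D _ _; exact: bondnm_mono.
  by move=> C; exact: bondnm_lvl.
apply: homotopic_on_trans.
  apply: homotopic_on_eq H1 => [C _ /=|C _]; last reflexivity.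
  by rewrite /q -bondnm_trans.
have H2 := homotopic_on_sym H1.
apply: (thick_near_homotopic (homotopic_on_mono H2) (homotopic_on_in H2) gg md).
move=> C b c LC /= /(bondk_near hY)[b' [rb' bb']] Cc.
have [a [Aa ca ra]] := gr N c; have LD := bondnm_lvl hX pm LC.
have em : epsX m < epsX p / 2.
  exact: le_lt_trans (eps_le hX Nm) (eps_half hX p).
(* Distances from [a] are below [epsX p + 4 * epsX m + 2 * (epsX p - epsX m)]; this is less than
   [4 * epsX p] because [p < m] gives [epsX m < epsX p / 2]. *)
have LU : lvlX p ([set a] `|` q C).
  apply: lvl_setU; [exact: (lvl_set1 hX) | exact: LD |].
  move=> _ c' -> /(bondnm_near hX pm)[c1 [Cc1 cc1]].
  have := lvl_mdist LC Cc Cc1; have := metric_triangle a c c'.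
  by have := metric_triangle c c1 c'; rewrite (metric_sym a c); lra.
have E := pro_rep_lvl Pr LU.
have := lvl_mdist E (pro_rep_mono Pr (lvl_set1 hX Aa) LU (@subsetUl _ _ _) ra)
  (pro_rep_mono Pr LD LU (@subsetUr _ _ _) rb').
have := metric_triangle (g N c) b' b; have := eps_gt0 hY N.
by move: bb' small; rewrite -/N; lra.
Qed.

Lemma linked_pro_equiv r s g h : pro_rep epsX AX epsY AY r ->
  pro_rep epsX AX epsY AY s -> fin_sel r g -> fin_sel s h ->
  prox_equiv g h -> pro_equiv epsX AX epsY AY r s.
Proof.
move=> Pr Ps gr hs gh n; have en := eps_gt0 hY n.
have en2 : 0 < epsY n / 2 by lra.
(* [n0] passes the threshold of [gh]; two further halvings give [4 * epsY N <= epsY n]. *)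
have [n0 H0] := gh _ en2; pose k := (n0 + 2)%N; pose N := (n + k)%N.
have [d [d0 dgh]] : linked (epsY n / 2) (g N) (h N) by apply: H0; rewrite /N /k; lia.
have small : 4 * epsY N <= epsY n.
  have : epsY N <= epsY n.+2 by apply: (eps_le hY); rewrite /N /k; lia.
  by have := eps_half hY n; have := eps_half hY n.+1; lra.
have d4 : 0 < d / 4 by lra.
have [m0 M0] := eps_small hX d4.
pose m := (m0 + (r.1 N + s.1 N)).+1.
have md : 4 * epsX m <= d by have : epsX m < d / 4 by [apply: M0; rewrite /m; lia]; lra.
have [[rh _ _] [sh _ _]] := (Pr, Ps).
have rn : (r.1 n <= r.1 N)%N by apply: rh; rewrite /N; lia.
have sn : (s.1 n <= s.1 N)%N by apply: sh; rewrite /N; lia.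
exists m; split; [rewrite /m; lia | rewrite /m; lia |].
apply: homotopic_on_trans.
  apply: (fin_sel_thick (k := k) Pr gr (chained_contig dgh) md) => //.
  by rewrite /m -/N; lia.
apply: homotopic_on_trans (thick_homotopic dgh md) _.
apply: homotopic_on_sym.
apply: (fin_sel_thick (k := k) Ps hs (chained_contig (chained_sym dgh)) md) => //.
by rewrite /m -/N; lia.
Qed.

Lemma fin_sel_surj (g : nat -> X -> Y) : prox g ->
  exists r g', [/\ pro_rep epsX AX epsY AY r, fin_sel r g' & prox_equiv g' g].
Proof.
move=> Pg; have e2 n : 0 < epsY n / 2 by have := eps_gt0 hY n; lra.
have [K0 K0P] := choice (fun n => prox_linked Pg (e2 n)).
(* The summand [n] keeps [K] above the identity, so that [G] is equivalent to [g]. *)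
have [K [Kh KP]] := monotone_majorant (fun n => K0 n + n)%N.
pose G n := g (K n).
have Glink n : linked (epsY n / 2) (G n) (G n.+1).
  apply: K0P; first by have := KP n; lia.
  by have := KP n; have := Kh _ _ (leqnSn n); lia.
have [d dP] := choice Glink.
(* The factor [6] accommodates a member of a level, below [4 * epsX], and a bonding drift of at most
   [2 * epsX]. *)
have /choice[P0 P0P] n : exists k, forall m, (k <= m)%N -> 6 * epsX m <= d n.
  have d6 : 0 < d n / 6 by have [] := dP n; lra.
  have [m M] := eps_small hX d6; exists m => m' /M; lra.
have [phi [phih phiP]] := monotone_majorant P0.
have dphi n m : (phi n <= m)%N -> 6 * epsX m <= d n.
  by move=> nm; apply: P0P; exact: leq_trans nm.
pose r := (phi, fun n => thick (G n) n).
have cG n : contig (d n) (epsY n / 2) (G n) (G n).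
  by have [_ /chained_contig] := dP n.
have d4 n m : (phi n <= m)%N -> 4 * epsX m <= d n.
  by move=> /dphi; have := eps_gt0 hX m; lra.
have Pr : pro_rep epsX AX epsY AY r.
  split=> // n /=.
    split; first by apply/within_alexP; exact: thick_mono.
    by move=> C; apply: (thick_lvl (cG n)); exact: d4.
  have pn := phih _ _ (leqnSn n); have dn := (dP n).2.
  have cG1 := chained_contig (chained_sym dn).
  have en := eps_half hY n; have ey := eps_gt0 hY n.
  have ex := eps_gt0 hX (phi n.+1).
  (* Both composites are compared with direct thickenings at level [n], of [G n.+1] and of [G n],
     which the chain between these functions connects. *)
  apply: (@homotopic_on_trans _ _ _ _ _ _ (thick (G n.+1) n)).
    apply: (thick_near_homotopic _ _ cG1) => [C D _ _ CD|C LC| |C b c LC].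
    - by apply: bond_mono; exact: thickS.
    - apply: (bond_lvl hY); apply: (thick_lvl (cG n.+1)) LC; exact: d4.
    - exact: d4.
    move=> [_ [b1 [[_ [c1 [Cc1 cb1]]] bb1]]] Cc.
    have cc1 : mdist c c1 < d n.
      by apply: lt_le_trans (d4 n _ pn); exact: (lvl_mdist LC).
    have [? _ _] := cG1 _ _ cc1.
    have := metric_triangle (G n.+1 c) (G n.+1 c1) b.
    by have := metric_triangle (G n.+1 c1) b1 b; lra.
  apply: homotopic_on_trans (thick_homotopic (chained_sym dn) (d4 n _ pn)) _.
  apply/homotopic_on_sym; apply: (thick_near_homotopic _ _ (cG n) (d4 n _ pn)).
  - by move=> C D _ _ CD; apply: thickS; exact: bondnm_mono.
  - move=> C LC; apply: (thick_lvl (cG n) (d4 n _ (leqnn _))).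
    exact: bondnm_lvl LC.
  move=> C b c LC [_ [c' [Cc' cb']]] Cc.
  have [c1 [Cc1 cc1]] := bondnm_near hX pn Cc'.
  have cc' : mdist c c' < d n.
    have := lvl_mdist LC Cc Cc1; have := metric_triangle c c1 c'.
    have := dphi n _ (leqnn _); have := eps_le hX pn; lra.
  have [? _ _] := cG n _ _ cc'.
  by have := metric_triangle (G n c) (G n c') b; lra.
have [g' gr] := fin_sel_exists Pr.
exists r, g'; split=> //.
have sG : prox_equiv (g \o K) g.
  by apply: prox_subseq => // n; have := KP n; lia.
move=> e e0; have [n1 N1] := sG e e0.
have e4 : 0 < e / 4 by lra.
have [n2 N2] := eps_small hY e4; exists (maxn n1 n2) => n.
rewrite geq_max => /andP[n1n n2n]; apply: linked_trans (N1 n n1n).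
have ey := eps_gt0 hY n; have ex := eps_gt0 hX (phi n).
have := N2 n n2n => small.
apply: (@contig_linked _ _ _ (2 * epsX (phi n))); first lra.
have [a aP] := choice (gr n).
have near x : exists c, mdist x c < epsX (phi n) /\ mdist (G n c) (g' n x) < epsY n.
  have [_ xa [_ [c [-> cb]]]] := aP x.
  by exists (a x).
move=> x x' xx'; have [c [xc cg]] := near x; have [c' [xc' cg']] := near x'.
have dn := dphi n _ (leqnn _).
have cc' : mdist c c' < d n.
  have := metric_triangle c x c'; have := metric_triangle x x' c'.
  by rewrite (metric_sym c x); lra.
have cx' : mdist c x' < d n.
  by have := metric_triangle c x x'; rewrite (metric_sym c x); lra.
have xx : mdist x x' < d n by lra.
have [Gcc _ _] := cG n _ _ cc'; have [Gcx _ _] := cG n _ _ cx'.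
have [Gxx _ _] := cG n _ _ xx; change ((g \o K) n) with (G n); split.
- have := metric_triangle (g' n x) (G n c) (g' n x').
  have := metric_triangle (G n c) (G n c') (g' n x').
  by rewrite (metric_sym (g' n x) (G n c)); lra.
- by lra.
- have := metric_triangle (g' n x) (G n c) (G n x').
  by rewrite (metric_sym (g' n x) (G n c)); lra.
Qed.

Lemma fin_encodes : encodes (pro_rep epsX AX epsY AY) (pro_equiv epsX AX epsY AY)
  prox prox_equiv fin_sel.
Proof.
split.
- exact: fin_sel_exists.
- exact: fin_sel_prox.
- by move=> r s g h Pr Ps rg sh; split;
    [exact: pro_equiv_linked | exact: linked_pro_equiv].
- exact: fin_sel_surj.
Qed.

End FiniteModel.

(** * Fundamental sequences in the Hilbert cube *)

Section HilbertCubeDistance.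
Context {R : realType}.
Implicit Types (x y z : HC R) (e : R).

(** The truncation at [1] bounds the supremum on all of [HC R]; the weights tend to zero, so a ball
    constrains finitely many coordinates and the topology is the product one. *)
Definition hc_coord x y (n : nat) : R := Num.min 1 `|x n - y n| / n.+1%:R.

(* A supremum rather than a sum over the coordinates, so that balls are convex. *)
Definition hc_dist x y : R := sup (range (hc_coord x y)).

Lemma hc_coord_ge0 x y n : 0 <= hc_coord x y n.
Proof. by rewrite divr_ge0 // le_min ler01 normr_ge0. Qed.

Lemma hc_coord_le1 x y n : hc_coord x y n <= n.+1%:R^-1.
Proof. by rewrite ler_pdivrMr // mulVf // ge_min lexx. Qed.

Lemma hc_coord_le_dist x y n : hc_coord x y n <= hc_dist x y.
Proof.
apply: ub_le_sup; last by exists n.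
exists 1 => _ [m _ <-]; apply: le_trans (hc_coord_le1 _ _ _) _.
by rewrite invf_le1 // ler1n.
Qed.

Lemma hc_dist_le x y e : (forall n, hc_coord x y n <= e) -> hc_dist x y <= e.
Proof.
move=> xye; rewrite /hc_dist; apply: ge_sup; first by exists (hc_coord x y 0), 0.
by move=> _ [n _ <-].
Qed.

(** In each coordinate a closed ball is the whole line or an interval; this is the source of its
    convexity. *)
Lemma hc_coord_le x y e n : hc_coord x y n <= e <->
  1 <= e * n.+1%:R \/ `|x n - y n| <= e * n.+1%:R.
Proof. by rewrite ler_pdivrMr // ge_min; split=> /orP. Qed.

Lemma hc_dist_ge0 x y : 0 <= hc_dist x y.
Proof. exact: le_trans (hc_coord_ge0 x y 0) (hc_coord_le_dist _ _ _). Qed.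

Lemma hc_dist_sym x y : hc_dist x y = hc_dist y x.
Proof.
rewrite /hc_dist (_ : hc_coord x y = hc_coord y x) //.
by apply/funext => n; rewrite /hc_coord distrC.
Qed.

Lemma hc_distxx x : hc_dist x x = 0.
Proof.
apply/eqP; rewrite eq_le hc_dist_ge0 andbT; apply: hc_dist_le => n.
by apply/hc_coord_le; right; rewrite subrr normr0 mul0r.
Qed.

Lemma hc_triangle x y z : hc_dist x z <= hc_dist x y + hc_dist y z.
Proof.
apply: hc_dist_le => n.
apply: le_trans (lerD (hc_coord_le_dist x y n) (hc_coord_le_dist y z n)).
rewrite /hc_coord -mulrDl ler_pM2r ?invr_gt0 //.
have := ler_distD (y n) (x n) (z n).
have := normr_ge0 (x n - y n); have := normr_ge0 (y n - z n).
by case: (lerP 1 `|x n - z n|); case: (lerP 1 `|x n - y n|);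
  case: (lerP 1 `|y n - z n|); lra.
Qed.

Lemma hc_triangle2 z x y : hc_dist x y <= hc_dist z x + hc_dist z y.
Proof. by rewrite (hc_dist_sym z x); exact: hc_triangle. Qed.

Lemma hc_dist_gt0 x y : x <> y -> 0 < hc_dist x y.
Proof.
move=> xy; rewrite lt_neqAle hc_dist_ge0 andbT eq_sym; apply/eqP => xy0.
apply: xy; apply/funext => n; apply/eqP.
rewrite -subr_eq0 -normr_eq0 eq_le normr_ge0 andbT.
have := hc_coord_le_dist x y n; rewrite xy0 => /hc_coord_le.
by rewrite mul0r => -[|//]; rewrite ler10.
Qed.

Lemma hc_cvgP (T : Type) (F : set_system T) (f : T -> HC R) x : Filter F ->
  f @ F --> x <-> forall n, (fun t => f t n) @ F --> x n.
Proof. by move=> FF; apply: (@pointwise_cvgP nat R (f @ F)). Qed.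

Lemma hc_nbhsP x (P : set (HC R)) :
  nbhs x P <-> exists e, 0 < e /\ forall y, hc_dist x y < e -> P y.
Proof.
split=> [xP|[e [e0 eP]]].
  (* The filter of balls converges to [x] coordinatewise, hence contains every neighbourhood of
     [x]. *)
  pose F : set_system (HC R) :=
    filter_from [set e | 0 < e] (fun e => [set y | hc_dist x y < e]).
  have FF : Filter F.
    apply: filter_from_filter; first by exists 1 => /=.
    move=> d d' /= d0 d'0; exists (Num.min d d'); first by rewrite /= lt_min d0.
    by move=> y /=; rewrite lt_min => /andP.
  suff /(_ P xP) : id @ F --> x.
    by move=> [e e0 eP]; exists e; split=> // y; exact: eP.
  apply/hc_cvgP => n; apply/cvgrPdist_lt => d d0.
  have n0 : 0 < n.+1%:R :> R by [].
  exists (Num.min 1 d / n.+1%:R).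
    by rewrite /= divr_gt0 // lt_min ltr01.
  move=> y /= xy; have := le_lt_trans (hc_coord_le_dist x y n) xy.
  rewrite ltr_pM2r ?invr_gt0 //.
  by case: (lerP 1 `|x n - y n|); case: (lerP 1 d); lra.
pose N : set_system (HC R) := nbhs x; have NF : Filter N := nbhs_filter x.
have Ncoord n d : 0 < d -> N [set y | `|x n - y n| < d].
  have /hc_cvgP/(_ n)/cvgrPdist_lt : id @ N --> x by exact: cvg_id.
  exact.
have {Ncoord} near m d : 0 < d ->
    N [set y | forall n, (n < m)%N -> `|x n - y n| < d].
  move=> d0; elim: m => [|m IH]; first exact: filterE.
  apply: filterS (filterI IH (Ncoord m d d0)) => y [yN xyN] n.
  by rewrite ltnS leq_eqVlt => /predU1P[->|/yN].
have e2 : 0 < e / 2 by rewrite divr_gt0.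
(* From this index on the weight alone is at most [e / 2]. *)
apply: filterS (near (Num.truncn (e / 2)^-1).+1 _ e2) => y xy.
apply: eP; apply: (@le_lt_trans _ _ (e / 2)); last by lra.
apply: hc_dist_le => n; have [nN|Nn] := ltnP n (Num.truncn (e / 2)^-1).+1.
  apply/hc_coord_le; right; apply: ltW; apply: lt_le_trans (xy n nN) _.
  by rewrite ler_peMr ?ler1n // ltW.
apply: le_trans (hc_coord_le1 _ _ _) _; rewrite invf_ple ?posrE //.
apply: le_trans (ltW (Num.Theory.truncnS_gt _)) _.
by rewrite ler_nat ltnW.
Qed.

Lemma hc_cvg_distP (T : Type) (F : set_system T) (f : T -> HC R) x : Filter F ->
  f @ F --> x <-> forall e, 0 < e -> \forall t \near F, hc_dist x (f t) < e.
Proof.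
move=> FF; split=> [fx e e0|fx P /hc_nbhsP[e [e0 eP]]].
  by apply: (fx [set y | hc_dist x y < e]); apply/hc_nbhsP; exists e.
by apply: filterS (fx e e0) => t; exact: eP.
Qed.

Lemma hc_dist_cvg (T : Type) (F : set_system T) (f : T -> HC R) a x : Filter F ->
  f @ F --> x -> (fun t => hc_dist a (f t)) @ F --> hc_dist a x.
Proof.
move=> FF /hc_cvg_distP fx; apply/cvgrPdist_lt => e e0.
apply: filterS (fx e e0) => t xt.
have := hc_triangle a x (f t); have := hc_triangle2 (f t) a x.
rewrite (hc_dist_sym (f t) a) (hc_dist_sym (f t) x) => *.
by apply: le_lt_trans xt; rewrite ler_norml; lra.
Qed.

Definition hc_line (t : R) x y : HC R := fun n => x n + t * (y n - x n).

Lemma hc_line_dist t x y z e : unit_interval R t ->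
  hc_dist z x <= e -> hc_dist z y <= e -> hc_dist z (hc_line t x y) <= e.
Proof.
move=> /andP[t0 t1] zx zy; apply: hc_dist_le => n; apply/hc_coord_le.
have /hc_coord_le[|x1] := le_trans (hc_coord_le_dist z x n) zx; first by left.
have /hc_coord_le[|y1] := le_trans (hc_coord_le_dist z y n) zy; first by left.
right; rewrite /hc_line; move: x1 y1; rewrite !ler_norml.
by move: (e * _) (z n) (x n) (y n) => c a b d; nra.
Qed.

Lemma hc_line_cube t x y : unit_interval R t ->
  hcube R x -> hcube R y -> hcube R (hc_line t x y).
Proof.
move=> /andP[t0 t1] Qx Qy n; have := Qx n; have := Qy n; rewrite /hc_line.
by move: (x n) (y n) => a b; nra.
Qed.

Lemma hc_line_homotopic (U V : set (HC R)) (f g : HC R -> HC R) :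
  {within U, continuous f} -> {within U, continuous g} ->
  (forall x t, U x -> unit_interval R t -> V (hc_line t (f x) (g x))) ->
  homotopic_on R U V f g.
Proof.
move=> cf cg UV; exists (fun z : HC R * R => hc_line z.2 (f z.1) (g z.1)); split.
- apply/subspace_continuousP => -[x t] [/= Ux It].
  pose N : set_system (HC R * R) := within (U `*` unit_interval R) (nbhs (x, t)).
  have NF : Filter N by apply: within_filter; exact: nbhs_filter.
  have cfst : fst @ N --> within U (nbhs x).
    move=> W xW; exists ([set y | U y -> W y], setT) => /=.
      by split=> //; exact: filterT.
    by move=> [y s] [/= UW _] [Uy _]; exact: UW.
  have csnd : snd @ N --> t.
    move=> W tW; exists (setT, W) => /=; first by split=> //; exact: filterT.
    by move=> [y s] [_ Ws] _.
  have cf' := cvg_comp _ _ cfst ((subspace_continuousP _ _).1 cf x Ux).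
  have cg' := cvg_comp _ _ cfst ((subspace_continuousP _ _).1 cg x Ux).
  apply/hc_cvgP => n.
  have cfn := (hc_cvgP _ _ NF).1 cf' n; have cgn := (hc_cvgP _ _ NF).1 cg' n.
  exact: (cvgD cfn (cvgM csnd (cvgB cgn cfn))).
- by move=> x t Ux It; exact: UV.
- move=> x Ux; split; apply/funext => n; rewrite /hc_line /=.
    by rewrite mul0r addr0.
  by rewrite mul1r addrC subrK.
Qed.

End HilbertCubeDistance.

(** A Lebesgue number argument, through near-covering compactness and the filter of small positive
    radii. *)
Lemma compact_uniform {R : realType} (X : metricType R) (P : X -> R -> Prop) :
  compact [set: X] ->
  (forall p d d', P p d -> d' <= d -> P p d') ->
  (forall p, exists d, 0 < d /\ forall q, mdist p q < d -> P q d) ->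
  exists d, 0 < d /\ forall p, P p d.
Proof.
move=> /compact_near_coveringP cX Pd loc.
have : \forall e \near (0 : R)^'+, [set: X] `<=` (fun p => P p e).
  apply: cX => p _; have [d [d0 dP]] := loc p.
  exists (ball p d, [set e | e < d]) => /=.
    by split; [exact: nbhsx_ballx | exact: nbhs_right_lt].
  move=> [q e] /= [pq ed]; apply: Pd (ltW ed); apply: dP.
  by move: pq; rewrite ballEmdist.
move=> /(filterI (nbhs_right_gt (0 : R)))/filter_ex[d [d0 dP]].
by exists d; split=> // p; exact: dP.
Qed.

(** * Uniform estimates and tubes around an embedded compact space *)

Section Embedding.
Context {R : realType} {X : metricType R}.
Variable (i : X -> HC R).
Hypotheses (cX : compact [set: X]) (ei : hc_embedding i).
Notation I := (unit_interval R).

Lemma emb_cube p : hcube R (i p). Proof. by case: ei. Qed.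

Lemma emb_cont p e : 0 < e ->
  exists d, 0 < d /\ forall q, mdist p q < d -> hc_dist (i p) (i q) < e.
Proof.
move=> e0; have [ci _ _] := ei.
have : nbhs p (i @^-1` [set x | hc_dist (i p) x < e]).
  by apply: (ci p); apply/hc_nbhsP; exists e.
move=> /nbhs_ballP[d /= d0 dP]; exists d; split=> // q pq.
by apply: dP; rewrite ballEmdist.
Qed.

(** Uniform at a fixed time [t]: only [i p] runs over a compact set, while [x] is any point of [U]
    near it. Half of the radius moves [p] to [q], half moves [q] to [x]. *)
Lemma emb_homotopy_uniform (U : set (HC R)) (H : HC R * R -> HC R) t e :
  {within U `*` I, continuous H} -> range i `<=` U -> I t -> 0 < e ->
  exists d, 0 < d /\ forall p x s, U x -> I s -> hc_dist (i p) x < d ->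
    `|s - t| < d -> hc_dist (H (i p, t)) (H (x, s)) < e.
Proof.
move=> /within_homotopyP cH iU It e0.
have Ui p : U (i p) by apply: iU; exists p.
apply: (@compact_uniform R X (fun p d => forall x s, U x -> I s ->
  hc_dist (i p) x < d -> `|s - t| < d -> hc_dist (H (i p, t)) (H (x, s)) < e)) => //.
  move=> p d d' Hd dd x s Ux Is px st.
  by apply: Hd => //; [exact: lt_le_trans dd | exact: lt_le_trans dd].
move=> p; have e2 : 0 < e / 2 by lra.
have HW : nbhs (H (i p, t)) [set z | hc_dist (H (i p, t)) z < e / 2].
  by apply/hc_nbhsP; exists (e / 2).
have [N [d [/hc_nbhsP[d1 [d10 d1N]] d0 NP]]] := cH (i p) t (Ui p) It _ HW.
have m0 : 0 < Num.min d d1 / 2 by rewrite divr_gt0 // lt_min d0.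
have [r [r0 rP]] := emb_cont p m0.
exists (Num.min r (Num.min d d1 / 2)); split; first by rewrite lt_min r0.
move=> q; rewrite lt_min => /andP[pq _] x s Ux Is; rewrite !lt_min.
move=> /andP[_ qx] /andP[_ st].
have md : Num.min d d1 <= d by rewrite ge_min lexx.
have md1 : Num.min d d1 <= d1 by rewrite ge_min lexx orbT.
have piq := rP q pq.
have h1 : hc_dist (H (i p, t)) (H (i q, t)) < e / 2.
  by apply: NP; rewrite // ?subrr ?normr0 //; apply: d1N; lra.
have h2 : hc_dist (H (i p, t)) (H (x, s)) < e / 2.
  apply: NP => //; last by lra.
  by apply: d1N; have := hc_triangle (i p) (i q) x; lra.
by have := hc_triangle2 (H (i p, t)) (H (i q, t)) (H (x, s)); lra.
Qed.

Lemma emb_map_uniform (f : HC R -> HC R) e :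
  {within hcube R, continuous f} -> 0 < e ->
  exists d, 0 < d /\ forall p x, hcube R x -> hc_dist (i p) x < d ->
    hc_dist (f (i p)) (f x) < e.
Proof.
move=> cf e0; have cH : {within hcube R `*` I, continuous (fun z : HC R * R => f z.1)}.
  apply/within_homotopyP => x t Qx _ W fW.
  have /within_continuousP/(_ x Qx W fW) xW := cf.
  by exists [set y | hcube R y -> W (f y)], 1; split=> // y s /= + Qy _ _; exact.
have I0 := @unit_interval0 R.
have [|d [d0 dP]] := @emb_homotopy_uniform (hcube R) _ 0 e cH _ I0 e0.
  by move=> _ [p _ <-]; exact: emb_cube.
by exists d; split=> // p x Qx px; apply: (dP p x 0); rewrite // subrr normr0.
Qed.

Lemma emb_uniform e : 0 < e ->
  exists d, 0 < d /\ forall p q, mdist p q < d -> hc_dist (i p) (i q) < e.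
Proof.
move=> e0; apply: (@compact_uniform R X (fun p d => forall q, mdist p q < d ->
    hc_dist (i p) (i q) < e)) => //.
  by move=> p d d' Pd dd q pq; apply: Pd; exact: lt_le_trans dd.
move=> p; have e2 : 0 < e / 2 by lra.
have [d [d0 dP]] := emb_cont p e2; exists (d / 2); split; first by lra.
move=> q pq q' qq'; have := metric_triangle p q q'.
have p1 : mdist p q < d by lra.
move=> tr; have p2 : mdist p q' < d by lra.
have := dP q p1; have := dP q' p2.
by have := hc_triangle2 (i p) (i q) (i q'); lra.
Qed.

(** Uniform continuity of the inverse embedding. Compactness is used twice: over [q] with [p] fixed,
    where injectivity separates points, then over [p]. *)
Lemma emb_inv_uniform e : 0 < e ->
  exists d, 0 < d /\ forall p q, hc_dist (i p) (i q) < d -> mdist p q < e.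
Proof.
move=> e0; have e2 : 0 < e / 2 by lra.
have inj p : exists d, 0 < d /\ forall q, hc_dist (i p) (i q) < d -> mdist p q < e / 2.
  apply: (@compact_uniform R X (fun q d => hc_dist (i p) (i q) < d ->
    mdist p q < e / 2)) => //.
    by move=> q d d' Pd dd pq; apply: Pd; exact: lt_le_trans dd.
  move=> q; have [<-|pq] := pselect (p = q).
    by exists (e / 2); split.
  have c0 : 0 < hc_dist (i p) (i q) / 2.
    by rewrite divr_gt0 // hc_dist_gt0 // => ipq; apply: pq; case: ei => _ + _; apply.
  have [d [d0 dP]] := emb_cont q c0.
  exists (Num.min d (hc_dist (i p) (i q) / 2)); split; first by rewrite lt_min d0.
  move=> q'; rewrite !lt_min => /andP[qq' _] /andP[_ pq'].
  have := dP q' qq'; have := hc_triangle2 (i q') (i p) (i q).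
  by rewrite (hc_dist_sym (i q') (i p)) (hc_dist_sym (i q') (i q)); lra.
apply: (@compact_uniform R X (fun p d => forall q, hc_dist (i p) (i q) < d ->
    mdist p q < e)) => //.
  by move=> p d d' Pd dd q pq; apply: Pd; exact: lt_le_trans dd.
move=> p; have [d [d0 dP]] := inj p; have d2 : 0 < d / 2 by lra.
have [r [r0 rP]] := emb_cont p d2.
exists (Num.min (Num.min r (e / 2)) (d / 2)); split; first by rewrite !lt_min r0 e2.
move=> q; rewrite !lt_min => /andP[/andP[pr pe] _] q'; rewrite !lt_min => /andP[_ qq'].
have pq' : mdist p q' < e / 2.
  by apply: dP; have := hc_triangle (i p) (i q) (i q'); have := rP q pr; lra.
have := metric_triangle q p q'; rewrite (metric_sym q p); lra.
Qed.

Lemma qnbhd_uniform V : qnbhd (range i) V ->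
  exists e, 0 < e /\ forall p x, hcube R x -> hc_dist (i p) x < e -> V x.
Proof.
move=> [KV [N [oN VN]]].
apply: (@compact_uniform R X (fun p e => forall x, hcube R x ->
    hc_dist (i p) x < e -> V x)) => //.
  by move=> p d d' Pd dd x Qx px; apply: Pd => //; exact: lt_le_trans dd.
move=> p; have : V (i p) by apply: KV; exists p.
rewrite VN => -[Np _]; have /hc_nbhsP[d [d0 dN]] := open_nbhs_nbhs (conj oN Np).
have d2 : 0 < d / 2 by lra.
have [r [r0 rP]] := emb_cont p d2.
exists (Num.min r (d / 2)); split; first by rewrite lt_min r0.
move=> q; rewrite lt_min => /andP[pq _] x Qx; rewrite lt_min => /andP[_ qx].
split=> //; apply: dN; have := rP q pq; have := hc_triangle (i p) (i q) x; lra.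
Qed.

(** By [qnbhd_uniform] these tubes form a base of neighbourhoods of the image in the cube. *)
Definition qtube e : set (HC R) :=
  [set x | hcube R x /\ exists p, hc_dist (i p) x < e].

Lemma qtube_qnbhd e : 0 < e -> qnbhd (range i) (qtube e).
Proof.
move=> e0; split.
  by move=> _ [p _ <-]; split; [exact: emb_cube | exists p; rewrite hc_distxx].
exists [set x | exists p, hc_dist (i p) x < e]; split; last first.
  by apply/seteqP; split=> x [].
rewrite openE => x [p px]; apply/hc_nbhsP; exists (e - hc_dist (i p) x).
split; first by lra.
by move=> y xy; exists p; have := hc_triangle (i p) x y; lra.
Qed.

Lemma qnbhdI (K V W : set (HC R)) :
  qnbhd K V -> qnbhd K W -> qnbhd K (V `&` W).
Proof.
move=> [KV [N [oN VN]]] [KW [P [oP WP]]]; split.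
  by move=> x Kx; split; [exact: KV | exact: KW].
rewrite VN WP; exists (N `&` P); split; first exact: openI.
by rewrite setIACA setIid.
Qed.

End Embedding.

(** * From functions on a net to maps of the cube *)

Section Blend.
Context {R : realType} {X Y : metricType R}.
Variables (iX : X -> HC R) (iY : Y -> HC R).
Hypotheses (eY : hc_embedding iY).
Implicit Types (f : HC R -> HC R) (delta : R) (s : seq X) (h : X -> Y).

(** It vanishes beyond [2 * delta], which localises the blend, and exceeds [delta] within radius
    [delta], which makes the mass at least [delta] near the net. *)
Definition bump delta (a : X) (x : HC R) : R :=
  Num.max 0 (2 * delta - hc_dist (iX a) x).

Definition mass delta s x := \sum_(a <- s) bump delta a x.

(* A partition of unity over the net [s], with the remaining weight
   [delta - mass] given to [f]: no division by zero away from the net, and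
   [f] plays no role where [delta <= mass]. *)
Definition blend f delta s h (x : HC R) : HC R := fun n =>
  ((Num.max delta (mass delta s x) - mass delta s x) * f x n
    + \sum_(a <- s) bump delta a x * iY (h a) n) / Num.max delta (mass delta s x).

Lemma bump_ge0 delta a x : 0 <= bump delta a x.
Proof. by rewrite le_max lexx. Qed.

Lemma bump_eq0 delta a x : ~ hc_dist (iX a) x < 2 * delta -> bump delta a x = 0.
Proof. by move=> /negP; rewrite -leNgt /bump => ax; apply/max_idPl; lra. Qed.

Lemma mass_max_gt0 delta s x : 0 < delta -> 0 < Num.max delta (mass delta s x).
Proof. by move=> d0; rewrite lt_max d0. Qed.

Lemma mass_ge_bump delta s x a : a \in s -> bump delta a x <= mass delta s x.
Proof.
move=> sa; rewrite /mass (big_rem a sa) /= lerDl.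
by apply: sumr_ge0 => b _; exact: bump_ge0.
Qed.

Lemma mass_ge delta s x a : a \in s -> hc_dist (iX a) x < delta ->
  delta <= mass delta s x.
Proof.
move=> sa ax; apply: le_trans (mass_ge_bump _ _ sa).
by rewrite le_max; apply/orP; right; lra.
Qed.

Lemma blend_far f delta s h x : 0 < delta ->
  (forall a, a \in s -> ~ hc_dist (iX a) x < 2 * delta) ->
  blend f delta s h x = f x.
Proof.
move=> d0 far; have b0 a : a \in s -> bump delta a x = 0.
  by move=> sa; apply: bump_eq0; exact: far.
have m0 : mass delta s x = 0.
  by rewrite /mass big_seq big1 // => a; exact: b0.
apply/funext => n; rewrite /blend m0 subr0 big_seq big1; last first.
  by move=> a sa; rewrite b0 // mul0r.
by have := mass_max_gt0 s x d0; rewrite m0 => M0; rewrite addr0 mulrC mulKf ?gt_eqF.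
Qed.

(** The blend is a convex combination, so a closed ball containing all values of nonzero weight
    contains it. Coordinatewise, each bound is weighted, summed and compared after clearing the
    denominator [M]. *)
Lemma blend_dist f delta s h x z e : 0 < delta ->
  (forall a, a \in s -> hc_dist (iX a) x < 2 * delta ->
     hc_dist z (iY (h a)) <= e) ->
  (mass delta s x < delta -> hc_dist z (f x) <= e) ->
  hc_dist z (blend f delta s h x) <= e.
Proof.
move=> d0 ze zf; apply: hc_dist_le => n; apply/hc_coord_le.
have [c1|c1] := lerP 1 (e * n.+1%:R); [by left | right].
set c := e * _ in c1 *.
have close w : hc_dist z w <= e -> `|z n - w n| <= c.
  move=> zw; have /hc_coord_le[|//] := le_trans (hc_coord_le_dist z w n) zw.
  by rewrite -/c; lra.
have M0 := mass_max_gt0 s x d0; rewrite /blend.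
set M := Num.max delta _ in M0 *; set S := mass delta s x.
have SM : 0 <= M - S by rewrite subr_ge0 le_max lexx orbT.
rewrite ler_norml -(ler_pM2r M0) -[_ <= c](ler_pM2r M0) mulrBl divfK ?gt_eqF //.
have hsum : `|\sum_(a <- s) bump delta a x * (z n - iY (h a) n)| <= S * c.
  apply: le_trans (ler_norm_sum _ _ _) _; rewrite /S /mass mulr_suml.
  rewrite big_seq [leRHS]big_seq; apply: ler_sum => a sa.
  rewrite normrM (ger0_norm (bump_ge0 _ _ _)).
  have [ax|ax] := pselect (hc_dist (iX a) x < 2 * delta); last first.
    by rewrite (bump_eq0 ax) !mul0r.
  by apply: ler_wpM2l; [exact: bump_ge0 | apply: close; exact: ze].
have hf : `|(M - S) * (z n - f x n)| <= (M - S) * c.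
  rewrite normrM (ger0_norm SM); have [Sd|dS] := ltP S delta.
    by apply: ler_wpM2l => //; apply: close; exact: zf.
  by rewrite /M (max_idPr dS) subrr !mul0r.
have split_sum : \sum_(a <- s) bump delta a x * (z n - iY (h a) n) =
    S * z n - \sum_(a <- s) bump delta a x * iY (h a) n.
  rewrite /S /mass mulr_suml -sumrB; apply: eq_bigr => a _; exact: mulrBr.
move: hsum hf; rewrite split_sum !ler_norml.
move: (\sum_(a <- s) _ * _) (f x n) (z n) => B F Z; rewrite !mulrBr !mulrBl; lra.
Qed.

Lemma blend_cube f delta s h x : 0 < delta -> hcube R (f x) ->
  hcube R (blend f delta s h x).
Proof.
move=> d0 Qf n; have M0 := mass_max_gt0 s x d0; rewrite /blend.
set M := Num.max delta _ in M0 *; set S := mass delta s x.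
have SM : 0 <= M - S by rewrite subr_ge0 le_max lexx orbT.
have Qh a : 0 <= iY (h a) n <= 1 by exact: emb_cube.
have B0 : 0 <= \sum_(a <- s) bump delta a x * iY (h a) n.
  by apply: sumr_ge0 => a _; have /andP[? _] := Qh a; rewrite mulr_ge0 ?bump_ge0.
have BS : \sum_(a <- s) bump delta a x * iY (h a) n <= S.
  apply: ler_sum => a _; have /andP[_ ?] := Qh a.
  by rewrite ler_piMr ?bump_ge0.
have /andP[f0 f1] := Qf n.
rewrite divr_ge0 ?(ltW M0) //=; last by rewrite addr_ge0 ?mulr_ge0.
rewrite ler_pdivrMr // mul1r.
have : (M - S) * f x n <= M - S by rewrite ler_piMr.
by lra.
Qed.

Lemma maxr_cvg (T : Type) (F : set_system T) (u : T -> R) (c l : R) : Filter F ->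
  u @ F --> l -> (fun t => Num.max c (u t)) @ F --> Num.max c l.
Proof.
move=> FF /cvgrPdist_lt ul; apply/cvgrPdist_lt => e /ul; apply: filterS => t.
by rewrite !ltr_norml; case: (lerP c l); case: (lerP c (u t)); lra.
Qed.

Lemma sum_cvg (T : Type) (F : set_system T) (K : Type) (r : seq K)
    (u : K -> T -> R) (l : K -> R) : Filter F ->
  (forall k, u k @ F --> l k) ->
  (fun t => \sum_(k <- r) u k t) @ F --> \sum_(k <- r) l k.
Proof.
move=> FF ul; elim: r => [|k r IH].
  by rewrite big_nil; under eq_fun do rewrite big_nil; exact: cvg_cst.
by rewrite big_cons; under eq_fun do rewrite big_cons; exact: (cvgD (ul k) IH).
Qed.

Lemma blend_continuous (U : set (HC R)) f delta s h : 0 < delta ->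
  {within U, continuous f} -> {within U, continuous (blend f delta s h)}.
Proof.
move=> d0 /subspace_continuousP cf; apply/subspace_continuousP => x Ux.
pose N : set_system (HC R) := within U (nbhs x).
have NF : Filter N by apply: within_filter; exact: nbhs_filter.
have cid : id @ N --> x by exact: cvg_within.
have cb a : (fun y => bump delta a y) @ N --> bump delta a x.
  by apply: maxr_cvg; apply: cvgB; [exact: cvg_cst | exact: hc_dist_cvg].
have cm : (fun y => mass delta s y) @ N --> mass delta s x by exact: sum_cvg.
have cM := maxr_cvg (c := delta) NF cm.
apply/hc_cvgP => n; have cfn := (hc_cvgP _ _ NF).1 (cf x Ux) n.
have cs : (fun y => \sum_(a <- s) bump delta a y * iY (h a) n) @ N -->
    \sum_(a <- s) bump delta a x * iY (h a) n.
  by apply: sum_cvg => a; apply: cvgM; [exact: cb | exact: cvg_cst].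
have M0 : Num.max delta (mass delta s x) != 0 by rewrite gt_eqF ?mass_max_gt0.
exact: (cvgM (cvgD (cvgM (cvgB cM cm) cfn) cs) (cvgV M0 cM)).
Qed.

Lemma line_homotopic_near (U V : set (HC R)) f g e :
  {within hcube R, continuous f} -> {within hcube R, continuous g} ->
  (forall x, hcube R x -> hcube R (f x)) ->
  (forall x, hcube R x -> hcube R (g x)) -> U `<=` hcube R ->
  (forall (p : Y) x, hcube R x -> hc_dist (iY p) x <= e -> V x) ->
  (forall x, U x -> exists p, hc_dist (iY p) (f x) <= e /\ hc_dist (iY p) (g x) <= e) ->
  homotopic_on R U V f g.
Proof.
move=> cf cg Qf Qg UQ eV near; apply: hc_line_homotopic.
- exact: continuous_subspaceW UQ cf.
- exact: continuous_subspaceW UQ cg.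
- move=> x t Ux It; have [p [pf pg]] := near x Ux; have Qx := UQ x Ux.
  apply: (eV p); last exact: hc_line_dist.
  by apply: hc_line_cube; [ | exact: Qf | exact: Qg].
Qed.

End Blend.

(** * Fundamental sequences and proximate sequences *)

Section HilbertModel.
Context {R : realType} {X Y : metricType R}.
Variables (iX : X -> HC R) (iY : Y -> HC R).
Hypotheses (cX : compact [set: X]) (cY : compact [set: Y]).
Hypotheses (eX : hc_embedding iX) (eY : hc_embedding iY).
Hypothesis net : forall r : R, 0 < r ->
  exists s : seq X, forall p, exists a, a \in s /\ mdist p a < r.
Notation I := (unit_interval R).
Notation fseq := (fund_seq (range iX) (range iY)).
Notation feq := (fund_equiv (range iX) (range iY)).

(** The tolerance is asymptotic because [f n] maps [X] close to [Y] only for large [n]. *)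
Definition hc_sel (f : nat -> HC R -> HC R) (g : nat -> X -> Y) :=
  forall e, 0 < e -> exists n0, forall n, (n0 <= n)%N ->
    forall x, hc_dist (iY (g n x)) (f n (iX x)) < e.

Lemma hc_net r : 0 < r ->
  exists s : seq X, forall p, exists a, a \in s /\ hc_dist (iX a) (iX p) < r.
Proof.
move=> r0; have [d [d0 dP]] := emb_uniform cX eX r0.
have [s sP] := net d0; exists s => p; have [a [sa pa]] := sP p.
by exists a; split=> //; rewrite hc_dist_sym; exact: dP.
Qed.

Lemma fund_seq_tube f e : fseq f -> 0 < e ->
  exists n0, forall n, (n0 <= n)%N -> forall x, exists y, hc_dist (iY y) (f n (iX x)) < e.
Proof.
move=> [_ ff] e0; have [U [[KU _] [n0 nP]]] := ff _ (qtube_qnbhd eY e0).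
exists n0 => n /nP/homotopic_on_in fU x.
by have [|_ ?] := fU (iX x); [apply: KU; exists x |].
Qed.

Lemma hc_sel_exists f : fseq f -> exists g, hc_sel f g.
Proof.
(* Distance within [1 / n.+1] of the infimum: one choice made at each [n] serves every tolerance. *)
move=> Pf; have /choice[g gP] (z : nat * X) : exists y, forall y',
    hc_dist (iY y) (f z.1 (iX z.2)) <
    hc_dist (iY y') (f z.1 (iX z.2)) + z.1.+1%:R^-1.
  case: z => n x /=; have [n0 nP] := fund_seq_tube Pf (@ltr01 R).
  have [y _] := nP n0 (leqnn _) x.
  pose E := range (fun y => hc_dist (iY y) (f n (iX x))).
  have lE : has_lbound E by exists 0 => _ [w _ <-]; exact: hc_dist_ge0.
  have hE : has_inf E by split=> //; exists (hc_dist (iY y) (f n (iX x))), y.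
  have n0' : 0 < n.+1%:R^-1 :> R by rewrite invr_gt0.
  have [_ [w _ <-] wE] := inf_adherent n0' hE; exists w => y'.
  apply: lt_le_trans wE _; rewrite lerD2r; apply: ge_inf => //.
  by exists y'.
exists (fun n x => g (n, x)) => e e0; have e2 : 0 < e / 2 by lra.
have [n0 nP] := fund_seq_tube Pf e2; have [k0 kP] := small_inv e2.
exists (n0 + k0)%N => n nn x.
have [|y xy] := nP n _ x; first by lia.
apply: lt_trans (gP (n, x) y) _; rewrite [ltRHS]splitr; apply: ltrD => //.
by apply: (kP n); lia.
Qed.

(** Points of [Y] are selected within [e1] of [H]. Two selection errors and a movement of [H] below
    [2 * e1] stay under [5 * e1], hence under [e] in [Y]. *)
Lemma homotopy_linked (U : set (HC R)) e e1 (F G : HC R -> HC R) (g h : X -> Y) :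
  0 < e1 -> (forall p q, hc_dist (iY p) (iY q) < 5 * e1 -> mdist p q < e) ->
  range iX `<=` U -> homotopic_on R U (qtube iY e1) F G ->
  (forall x, hc_dist (iY (g x)) (F (iX x)) < e1) ->
  (forall x, hc_dist (iY (h x)) (G (iX x)) < e1) -> linked e g h.
Proof.
move=> e10 eP KU [H [cH HB H01]] gF hG.
have Ui x : U (iX x) by apply: KU; exists x.
have loc t : I t -> exists d, 0 < d /\ forall s, I s -> `|s - t| < d ->
    forall k k', (forall x, hc_dist (iY (k x)) (H (iX x, t)) < e1) ->
      (forall x, hc_dist (iY (k' x)) (H (iX x, s)) < e1) -> linked e k k'.
  move=> It; have [d [d0 dP]] := emb_homotopy_uniform cX eX cH KU It e10.
  have [d' [d'0 d'P]] := emb_uniform cX eX d0.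
  exists d; split=> // s Is st k k' kt ks; apply: (contig_linked d'0) => x x' xx'.
  have ixx := d'P _ _ xx'.
  have tt0 : `|t - t| < d by rewrite subrr normr0.
  have h1 := dP x _ t (Ui x') It ixx tt0.
  have h2 : hc_dist (H (iX x, t)) (H (iX x, s)) < e1.
    by apply: dP; rewrite ?hc_distxx.
  have h3 := dP x _ s (Ui x') Is ixx st.
  have [k1 k2] := (kt x, kt x'); have [l1 l2] := (ks x, ks x').
  have tri p q a b : hc_dist (iY p) a < e1 -> hc_dist (iY q) b < e1 ->
      hc_dist (iY p) (iY q) < 2 * e1 + hc_dist a b.
    move=> pa qb; have := hc_triangle (iY p) a (iY q).
    have := hc_triangle2 b a (iY q).
    by rewrite (hc_dist_sym b a) (hc_dist_sym b (iY q)); lra.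
  split; apply: eP.
  - by have := tri _ _ _ _ k1 k2; lra.
  - have := tri _ _ _ _ l1 l2.
    by have := hc_triangle2 (H (iX x, t)) (H (iX x, s)) (H (iX x', s)); lra.
  - by have := tri _ _ _ _ k1 l2; lra.
have /choice[k kP] (z : R * X) : exists y,
    I z.1 -> hc_dist (iY y) (H (iX z.2, z.1)) < e1.
  case: z => t x /=; have [It|nIt] := pselect (I t); last by exists (g x).
  by have [_ [y ?]] := HB _ _ (Ui x) It; exists y.
have I0 := @unit_interval0 R; have I1 := @unit_interval1 R.
have loc0 t k1 k2 : I t -> (forall x, hc_dist (iY (k1 x)) (H (iX x, t)) < e1) ->
    (forall x, hc_dist (iY (k2 x)) (H (iX x, t)) < e1) -> linked e k1 k2.
  move=> It; have [d [d0 dP]] := loc t It; apply: (dP t) => //.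
  by rewrite subrr normr0.
apply: (@linked_trans _ _ _ _ _ (fun x => k (0, x))).
  apply: (loc0 0) => // x; first by rewrite (H01 _ (Ui x)).1.
  exact: (kP (0, x)).
apply: (@linked_trans _ _ _ _ _ (fun x => k (1, x))); last first.
  apply: (loc0 1) => // x; first exact: (kP (1, x)).
  by rewrite (H01 _ (Ui x)).2.
apply: (@interval_chain _ _ (linked e) (fun t x => k (t, x))).
- exact: linked_sym.
- exact: linked_trans.
move=> t It; have [d [d0 dP]] := loc t It; exists d; split=> // s Is st.
by apply: (dP s) => // x; [exact: (kP (t, x)) | exact: (kP (s, x))].
Qed.

Lemma emb_inv_uniform5 e : 0 < e -> exists e1, 0 < e1 /\
  forall p q, hc_dist (iY p) (iY q) < 5 * e1 -> mdist p q < e.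
Proof.
move=> e0; have [d [d0 dP]] := emb_inv_uniform cY eY e0.
by exists (d / 5); split=> [|p q pq]; [lra | apply: dP; lra].
Qed.

Lemma hc_sel_prox f g : fseq f -> hc_sel f g -> prox g.
Proof.
move=> [_ ff] fg e e0; have [e1 [e10 eP]] := emb_inv_uniform5 e0.
have [U [[KU _] [n0 nP]]] := ff _ (qtube_qnbhd eY e10).
have [n1 n1P] := fg _ e10; exists (n0 + n1)%N => n nn.
apply: (homotopy_linked e10 eP KU (nP n _)); first by lia.
  by apply: n1P; lia.
by apply: n1P; lia.
Qed.

Lemma fund_equiv_linked f f' g g' : hc_sel f g -> hc_sel f' g' ->
  feq f f' -> prox_equiv g g'.
Proof.
move=> fg fg' ff e e0; have [e1 [e10 eP]] := emb_inv_uniform5 e0.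
have [U [[KU _] [n0 nP]]] := ff _ (qtube_qnbhd eY e10).
have [n1 n1P] := fg _ e10; have [n2 n2P] := fg' _ e10.
exists (n0 + n1 + n2)%N => n nn.
apply: (homotopy_linked e10 eP KU (nP n _)); first by lia.
  by apply: n1P; lia.
by apply: n2P; lia.
Qed.

Lemma fund_seq_far f V : fseq f -> qnbhd (range iY) V ->
  exists U, qnbhd (range iX) U /\ exists k0, forall k l, (k0 <= k)%N -> (k <= l)%N ->
    homotopic_on R U V (f k) (f l).
Proof.
move=> [_ ff] /ff[U [nU [k0 kP]]]; exists U; split=> //; exists k0 => k l k0k kl.
rewrite -(subnKC kl).
have := @homotopic_on_chain R _ _ U V (fun j => f (k + j)%N).
by rewrite addn0; apply=> j; rewrite addnS; apply: kP; lia.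
Qed.

(** Net points active at [x] are within [3 * delta] of [a], so [g] sends them close to [g a]; the
    mass at [x] is at least [delta], so [f0] gets no weight. *)
Lemma blend_near (f0 : HC R -> HC R) (g : X -> Y) (s : seq X) delta d e e1 p a x :
  0 < delta -> a \in s -> hc_dist (iX p) x < delta / 2 ->
  hc_dist (iX a) (iX p) < delta / 2 ->
  (forall q q', hc_dist (iX q) (iX q') < 4 * delta -> mdist q q' < d) ->
  (forall y y', mdist y y' < e1 -> hc_dist (iY y) (iY y') < e) ->
  contig d e1 g g ->
  hc_dist (iY (g a)) (blend iX iY f0 delta s g x) <= e.
Proof.
move=> d0 sa px ap sd ye gg.
have ax : hc_dist (iX a) x < delta by have := hc_triangle (iX a) (iX p) x; lra.
apply: blend_dist => // [b sb bx|].
  apply/ltW/ye; have [|//] := gg a b; apply: sd.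
  by have := hc_triangle (iX a) x (iX b); rewrite (hc_dist_sym x (iX b)); lra.
by have := mass_ge sa ax; lra.
Qed.

(** The scale of the chain from [g k] to [g' k] depends on [k], so a single large [k] is used: [f k]
    and [f' k] are joined near [X] by blends along the chain, and other indices are reached by
    homotopies within [f] and within [f']. *)
Lemma linked_fund_equiv f f' g g' : fseq f -> fseq f' ->
  hc_sel f g -> hc_sel f' g' -> prox_equiv g g' -> feq f f'.
Proof.
move=> Pf Pf' fg fg' gg V nV.
have [U [nU [k0 kP]]] := fund_seq_far Pf nV.
have [U' [nU' [k0' kP']]] := fund_seq_far Pf' nV.
have [e [e0 eV]] := qnbhd_uniform cY eY nV.
have e4 : 0 < e / 4 by lra.
have [e1 [e10 e1P]] := emb_uniform cY eY e4.
have [n0 n0P] := gg _ e10.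
have [n1 n1P] := fg _ e4; have [n2 n2P] := fg' _ e4.
have [k [k0k k0'k n0k [n1k n2k]]] : exists k, [/\ (k0 <= k)%N, (k0' <= k)%N,
    (n0 <= k)%N & (n1 <= k)%N /\ (n2 <= k)%N].
  by exists (k0 + k0' + n0 + n1 + n2)%N; split; last split; lia.
have [d [d0 [p [l [p0 pl pc]]]]] : linked e1 (g k) (g' k) by exact: n0P.
have [[fc _] [fc' _]] := (Pf, Pf').
have [[cf Qf] [cf' Qf']] := (fc k, fc' k).
have [r [r0 rP]] := emb_map_uniform cX eX cf e4.
have [r' [r'0 r'P]] := emb_map_uniform cX eX cf' e4.
have [eta [eta0 etaP]] := emb_inv_uniform cX eX d0.
(* [4 * delta] is at most three scales: uniformity of [f k], that of [f' k], and the scale [d] of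
   the chain read in the cube. *)
pose delta := Num.min (Num.min r r') eta / 4.
have m0 : 0 < Num.min (Num.min r r') eta by rewrite !lt_min r0 r'0.
have delta0 : 0 < delta by rewrite /delta; lra.
have dr : 4 * delta <= r.
  by rewrite /delta mulrC divfK ?pnatr_eq0 // !ge_min lexx.
have dr' : 4 * delta <= r'.
  by rewrite /delta mulrC divfK ?pnatr_eq0 // !ge_min lexx orbT.
have de : 4 * delta <= eta.
  by rewrite /delta mulrC divfK ?pnatr_eq0 // !ge_min lexx orbT.
have sd q q' : hc_dist (iX q) (iX q') < 4 * delta -> mdist q q' < d.
  by move=> qq; apply: etaP; lra.
have delta2 : 0 < delta / 2 by lra.
have [s sP] := hc_net delta2.
pose W := qtube iX (delta / 2); pose b h := blend iX iY (f k) delta s h.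
have cb h : {within hcube R, continuous (b h)} by exact: blend_continuous.
have Qb h x : hcube R x -> hcube R (b h x).
  by move=> Qx; apply: blend_cube => //; exact: Qf.
have WQ : W `<=` hcube R by move=> x [].
have eV' y x : hcube R x -> hc_dist (iY y) x <= e / 2 -> V x.
  by move=> Qx yx; apply: eV Qx _; lra.
have pcl i : contig d e1 (p i) (p i) := contig_refl (pc i).
have ends F h (cF : {within hcube R, continuous F}) :
    (forall x, hcube R x -> hcube R (F x)) ->
    (forall q x, hcube R x -> hc_dist (iX q) x < 4 * delta ->
       hc_dist (F (iX q)) (F x) < e / 4) ->
    (forall x, hc_dist (iY (h x)) (F (iX x)) < e / 4) -> contig d e1 h h ->
    homotopic_on R W V F (b h).
  move=> QF uF hF hh; apply: (line_homotopic_near cF (cb h) QF (Qb h) WQ eV').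
  move=> x [Qx [q qx]]; have [a [sa aq]] := sP q; exists (h a); split.
    have := hF a; have := hc_triangle (iY (h a)) (F (iX a)) (F x).
    have : hc_dist (F (iX a)) (F x) < e / 4.
      by apply: uF => //; have := hc_triangle (iX a) (iX q) x; lra.
    by lra.
  by apply: le_trans (blend_near (f k) delta0 sa qx aq sd e1P hh) _; lra.
have steps i : homotopic_on R W V (b (p i)) (b (p i.+1)).
  apply: (line_homotopic_near (cb _) (cb _) (Qb _) (Qb _) WQ eV').
  move=> x [Qx [q qx]]; have [a [sa aq]] := sP q; exists (p i a); split.
    by apply: le_trans (blend_near (f k) delta0 sa qx aq sd e1P (pcl i)) _; lra.
  have ax : hc_dist (iX a) x < delta by have := hc_triangle (iX a) (iX q) x; lra.
  apply: blend_dist => // [a' sa' ax'|]; last by have := mass_ge sa ax; lra.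
  apply: (@le_trans _ _ (e / 4)); last by lra.
  apply/ltW/e1P; have [|//] := pc i a a'; apply: sd.
  by have := hc_triangle (iX a) x (iX a'); rewrite (hc_dist_sym x (iX a')); lra.
have HW : homotopic_on R W V (f k) (f' k).
  have uf q x : hcube R x -> hc_dist (iX q) x < 4 * delta ->
      hc_dist (f k (iX q)) (f k x) < e / 4.
    by move=> Qx qx; apply: rP => //; lra.
  have uf' q x : hcube R x -> hc_dist (iX q) x < 4 * delta ->
      hc_dist (f' k (iX q)) (f' k x) < e / 4.
    by move=> Qx qx; apply: r'P => //; lra.
  have H1 := ends _ _ cf Qf uf (n1P k n1k).
  have H2 := ends _ _ cf' Qf' uf' (n2P k n2k).
  have H3 := homotopic_on_chain steps l.
  move: H3 (pcl 0%N) (pcl l); rewrite p0 (pl l) // => H3 c0 cl.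
  exact: homotopic_on_trans (H1 c0) (homotopic_on_trans H3 (homotopic_on_sym (H2 cl))).
exists (U `&` U' `&` W); split.
  by apply: qnbhdI; [exact: qnbhdI | exact: qtube_qnbhd].
exists k => j kj; apply: (@homotopic_on_trans _ _ _ _ _ _ (f k)).
  apply: (@homotopic_on_sub _ _ _ U); first by move=> x [[]].
  by apply/homotopic_on_sym/kP.
apply: (@homotopic_on_trans _ _ _ _ _ _ (f' k)).
  by apply: homotopic_on_sub HW => x [].
apply: (@homotopic_on_sub _ _ _ U'); first by move=> x [[]].
exact: kP'.
Qed.

(** The slowed sequence [h] has consecutive members one step apart, so that a single straight line
    joins [f j] to [f j.+1]. *)
Lemma hc_sel_surj (g : nat -> X -> Y) : prox g ->
  exists f h, [/\ fseq f, hc_sel f h & prox_equiv h g].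
Proof.
move=> Pg; have [h [kappa [d [d0 kh ku hc hg]]]] := prox_slow Pg.
have /choice[eta etaP] j : exists eta, 0 < eta /\
    forall q q', hc_dist (iX q) (iX q') < eta -> mdist q q' < d j.
  exact: emb_inv_uniform.
(* The factor [4] puts the support of stage [j.+1], of radius [2 * delta j.+1 <= delta j / 2] about
   the net, where [f j] already follows [h j]. *)
pose delta := fix F j := if j is j'.+1 then Num.min (F j' / 4) (eta j / 4)
  else eta 0%N / 4.
have delta0 j : 0 < delta j.
  elim: j => [|j IH] /=; first by have := (etaP 0%N).1; lra.
  by rewrite lt_min; have := (etaP j.+1).1; lra.
have deltaS j : delta j.+1 <= delta j / 4 by rewrite /= ge_min lexx.
have sd j q q' : hc_dist (iX q) (iX q') < 4 * delta j -> mdist q q' < d j.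
  move=> qq; apply: (etaP j).2; apply: lt_le_trans qq _.
  have : delta j <= eta j / 4 by case: j => [|j] /=; rewrite ?ge_min lexx ?orbT.
  by lra.
have delta2 j : 0 < delta j / 2 by have := delta0 j; lra.
have [s sP] := choice (fun j => hc_net (delta2 j)).
(* [f j.+1] follows [h j.+1] close to the image of [X] and equals [f j] away
   from it, so a single neighbourhood serves all the later homotopies. *)
pose o : HC R := fun=> 0.
pose f := fix F j := if j is j'.+1 then blend iX iY (F j') (delta j) (s j) (h j)
  else blend iX iY (fun=> o) (delta 0%N) (s 0%N) (h 0%N).
have fE j : exists f0, f j = blend iX iY f0 (delta j) (s j) (h j).
  by case: j => [|j]; [exists (fun=> o) | exists (f j)].
have fSE j : f j.+1 = blend iX iY (f j) (delta j.+1) (s j.+1) (h j.+1) by [].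
have fP j : {within hcube R, continuous (f j)} /\
    (forall x, hcube R x -> hcube R (f j x)).
  elim: j => [|j [IHc IHQ]]; split.
  - apply: blend_continuous => //; apply/within_continuousP => x Qx W oW.
    apply/hc_nbhsP; exists 1; split=> // y _ _.
    by have /hc_nbhsP[r [r0]] := oW; apply; rewrite hc_distxx.
  - by move=> x Qx; apply: blend_cube => // n; rewrite /o lexx ler01.
  - exact: blend_continuous.
  - by move=> x Qx; apply: blend_cube => //; exact: IHQ.
have small e : 0 < e -> exists k0, (forall y y', mdist y y' < k0.2 ->
    hc_dist (iY y) (iY y') < e) /\
    forall j, (k0.1 <= j)%N -> contig (d j) k0.2 (h j) (h j.+1).
  move=> e0; have [e1 [e10 e1P]] := emb_uniform cY eY e0.
  have [k kP] := small_inv e10; have [j0 j0P] := ku k.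
  exists (j0, e1); split=> //= j jj; apply: contig_le (hc j) => //.
  by apply/ltW/kP; apply: leq_trans j0P _; exact: kh.
pose W j := qtube iX (delta j / 2).
exists f, h; split=> //.
- split=> // V nV; have [e [e0 eV]] := qnbhd_uniform cY eY nV.
  have e2 : 0 < e / 2 by lra.
  have [[k0 e1] /= [e1P hj]] := small _ e2.
  have eV' y x : hcube R x -> hc_dist (iY y) x <= e / 2 -> V x.
    by move=> Qx yx; apply: eV Qx _; lra.
  have step j x : (k0 <= j)%N -> hcube R x -> f j.+1 x = f j x \/
      exists y, hc_dist (iY y) (f j x) <= e / 2 /\ hc_dist (iY y) (f j.+1 x) <= e / 2.
    move=> kj Qx; have [[a [sa ax]]|far] := pselect (exists a, a \in s j.+1 /\
        hc_dist (iX a) x < 2 * delta j.+1); last first.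
      by left; apply: blend_far => // a sa ax; apply: far; exists a.
    right; have dS := deltaS j.
    have ax2 : hc_dist (iX a) x < delta j / 2 by lra.
    have [b [sb ba]] := sP j a; exists (h j b).
    have fj : hc_dist (iY (h j b)) (f j x) <= e / 2.
      have [f0 ->] := fE j.
      exact: (blend_near f0 (delta0 j) sb ax2 ba (sd j) e1P (contig_refl (hj j kj))).
    (* Any weight left over goes to [f j x], which [fj] places near the same point; this covers the
       transition zone of the blend. *)
    split=> //; rewrite fSE; apply: blend_dist => // a' sa' ax'.
    apply/ltW/e1P; have [|//] := hj j kj b a'; apply: sd.
    have := hc_triangle (iX b) x (iX a'); rewrite (hc_dist_sym x (iX a')).
    by have := hc_triangle (iX b) (iX a) x; have := delta0 j; lra.
  (* When [f j.+1 x = f j x], [step] does not locate the value near [Y]; this is propagated from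
     stage [k0]. *)
  have fW j x : (k0 <= j)%N -> W k0 x -> exists y, hc_dist (iY y) (f j x) <= e / 2.
    move=> kj [Qx [q qx]]; rewrite -(subnKC kj).
    elim: (j - k0)%N => [|i [y IH]].
      have [b [sb bq]] := sP k0 q; exists (h k0 b); rewrite addn0.
      have [f0 ->] := fE k0.
      have hk := contig_refl (hj k0 (leqnn _)).
      exact: (blend_near f0 (delta0 k0) sb qx bq (sd k0) e1P hk).
    have ki : (k0 <= k0 + i)%N by lia.
    rewrite addnS; have [->|[z [_ zx]]] := step (k0 + i)%N x ki Qx; first by exists y.
    by exists z.
  exists (W k0); split; first exact: qtube_qnbhd.
  exists k0 => j kj; have [[cj Qj] [cj1 Qj1]] := (fP j, fP j.+1).
  apply: (line_homotopic_near cj cj1 Qj Qj1 _ eV'); first by move=> x [].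
  move=> x Wx; have [Qx _] := Wx; have [E|//] := step j x kj Qx.
  by have [y yx] := fW j x kj Wx; exists y; rewrite E.
- move=> e e0; have e2 : 0 < e / 2 by lra.
  have [[k0 e1] /= [e1P hj]] := small _ e2.
  exists k0 => j kj x; have [a [sa ax]] := sP j x; have dj := delta0 j.
  apply: (@le_lt_trans _ _ (e / 2)); last by lra.
  have [f0 ->] := fE j; apply: blend_dist => // [b sb bx|].
    apply/ltW/e1P; have [|//] := contig_refl (hj j kj) (x := x) (x' := b).
    by apply: sd; rewrite hc_dist_sym; lra.
  have ax' : hc_dist (iX a) (iX x) < delta j by lra.
  by have := mass_ge sa ax'; lra.
Qed.

Lemma hc_encodes : encodes fseq feq prox prox_equiv hc_sel.
Proof.
split.
- exact: hc_sel_exists.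
- exact: hc_sel_prox.
- by move=> f f' g g' Pf Pf' fg fg'; split;
    [exact: fund_equiv_linked | exact: linked_fund_equiv].
- exact: hc_sel_surj.
Qed.

End HilbertModel.

Theorem theorem4p7 (R : realType) (X Y : metricType R)
  (cX : compact [set: X]) (cY : compact [set: Y])
  (epsX : nat -> R) (AX : nat -> set X) (epsY : nat -> R) (AY : nat -> set Y)
  (hTX : finite_approx epsX AX) (hTY : finite_approx epsY AY)
  (iX : X -> HC R) (iY : Y -> HC R)
  (eX : hc_embedding iX) (eY : hc_embedding iY) :
  exists Phi : ShapeMor (range iX) (range iY) -> ProMor epsX AX epsY AY,
    bijective Phi.
Proof.
(* The nets for the shape side are read off the finite approximation of [X]. *)
have net r : 0 < r -> exists s : seq X, forall p, exists a, a \in s /\ mdist p a < r.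
  move=> r0; have [n /(_ n (leqnn n)) nr] := eps_small hTX r0.
  have [_ _ /(_ n)[/finite_seqP[s As] ApX]] := hTX.
  exists s => p; have [a [Aa pa]] := ApX p; exists a; split; last exact: lt_trans nr.
  by move: Aa; rewrite As.
(* [ShapeMor] and [ProMor] are both instances of [classes] by conversion. *)
exact: (encodes_bijective prox_equiv_on (hc_encodes cX cY eX eY net) (fin_encodes hTX hTY)).
Qed.
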